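(* Let $\Bbbk$ be any field. Let $M$ (resp. $\mathcal M$) be a simple supersolvable matroid (resp. simple supersolvable oriented matroid) of rank $r$ on $E=\{1,\dots,n\}$ with a complete flag $\emptyset=F_0\subsetneq F_1\subsetneq\cdots\subsetneq F_r=E$ of modular flats, let $F=F_{r-1}$ and $E_r=E\setminus F$. Let $G$ be a group of automorphisms of $M$ (resp. $\mathcal M$), let $H=\{g\in G: g(F)=F\}$, and let $\mathcal X=\Bbbk[E_r]$ be the permutation (resp. signed permutation) $\Bbbk H$-module on $E_r$. Let $A=\mathrm{OS}(M)$ and $B=\mathrm{OS}(M|_F)$ (resp. $A=\mathrm{VG}(\mathcal M)$ and $B=\mathrm{VG}(\mathcal M|_F)$). Then there are short exact sequences of graded $\Bbbk H$-modules (i) $0\to B\to A\!\downarrow^G_H\to \mathcal X\otimes B(-1)\to 0$, (ii) $0\to\mathcal X\otimes\big(A^!\!\downarrow^G_H\big)(-1)\to A^!\!\downarrow^G_H\to B^!\to0$.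
   Context: Matroids (via circuits), simple (no circuits of size $\le2$), flats, rank, modular flats ($r(F\vee F')+r(F\wedge F')=r(F)+r(F')$ for all flats $F'$), supersolvable (complete flag of modular flats); oriented matroids via signed circuits $(C_+,C_-)$ with underlying matroid circuits $C_+\cup C_-$. $M|_F$ (resp. $\mathcal M|_F$) is the restriction to ground set $F$ (circuits/signed circuits contained in $F$). $\mathrm{OS}(M)=\bigwedge(x_1,\dots,x_n)/(\partial x_C)$ with $\partial x_C=\sum_{j}(-1)^{j-1}x_{c_1}\wedge\cdots\widehat{x_{c_j}}\cdots\wedge x_{c_k}$ for circuits $C=\{c_1<\cdots<c_k\}$; $\mathrm{VG}(\mathcal M)=\Bbbk[x_1,\dots,x_n]/(x_i^2,\partial^\pm x_C)$ with $\partial^\pm x_C=\sum_{c\in C}\epsilon_C(c)\prod_{c'\in C\setminus c}x_{c'}$, $\epsilon_C(c)=\pm1$ according as $c\in C_\pm$ for a chosen signed circuit on $C$. Koszul dual: writing $A=\Bbbk\langle x\rangle/I$ quadratically, $A^!=\Bbbk\langle y\rangle/(I_2^\perp)$ with $(y_iy_j,x_kx_\ell)=\delta_{ik}\delta_{j\ell}$. Automorphisms of $M$ are permutations of $E$ preserving circuits, acting by permuting subscripts of $x_i,y_i$; automorphisms of $\mathcal M$ are signed permutations $\sigma$ of $\{\pm1,\dots,\pm n\}$ preserving signed circuits, acting by $\sigma(x_i)=\epsilon x_j$, $\sigma(y_i)=\epsilon y_j$ when $\sigma(i)=\epsilon j$. The signed permutation module $\mathcal X$ has basis $\{t_j\}_{j\in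 E_r}$ with $g(t_j)=\epsilon t_k$ when $g(j)=\epsilon k$. For a graded module $B$, $B(-1)_j=B_{j-1}$; $\downarrow^G_H$ is restriction. *)

(* Defs.v *)
From HB Require Import structures.
From mathcomp Require Import all_boot all_order all_fingroup all_algebra.
Set Implicit Arguments. Unset Strict Implicit. Unset Printing Implicit Defensive.
Import Order.TTheory GRing.Theory Num.Theory.
Local Open Scope ring_scope.

Section Matroid.
Variable n : nat.
Implicit Types (C : {set {set 'I_n}}) (S X Y : {set 'I_n}).

Definition matroid_circuits C : Prop :=
  [/\ set0 \notin C,
      (forall X Y, X \in C -> Y \in C -> X \subset Y -> X = Y) &
      (forall X Y e, X \in C -> Y \in C -> X != Y -> e \in X :&: Y ->
         exists2 Z, Z \in C & Z \subset (X :|: Y) :\ e)].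

Definition simple_matroid C : Prop := forall X, X \in C -> (2 < #|X|)%N.

Definition indep C S : bool := [forall X in C, ~~ (X \subset S)].

Definition rk C S : nat := \max_(I : {set 'I_n} | (I \subset S) && indep C I) #|I|.

Definition closure C S : {set 'I_n} := [set e | rk C (e |: S) == rk C S].

Definition flat C S : bool := closure C S == S.

(* join of flats = closure of the union, meet = intersection *)
Definition modular_flat C X : bool :=
  flat C X &&
  [forall Y, flat C Y ==>
     (rk C (closure C (X :|: Y)) + rk C (X :&: Y) == rk C X + rk C Y)%N].

Definition complete_modular_flag C (r : nat) (Fl : nat -> {set 'I_n}) : Prop :=
  [/\ Fl 0%N = set0, Fl r = setT,
      (forall i, (i < r)%N -> Fl i \proper Fl i.+1),
      (forall i, (i <= r)%N -> rk C (Fl i) = i) &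
      (forall i, (i <= r)%N -> modular_flat C (Fl i))].

Definition supersolvable C : Prop :=
  exists Fl, complete_modular_flag C (rk C setT) Fl.

Definition mat_aut C (g : {perm 'I_n}) : Prop :=
  forall X, (g @: X \in C) = (X \in C).

(* Oriented matroids: a signed set is a set of signed elements            *)
(* (false, i) = +i, (true, i) = -i.                                        *)
Implicit Types (SC : {set {set bool * 'I_n}}) (Z : {set bool * 'I_n}).

Definition spos Z : {set 'I_n} := [set i | (false, i) \in Z].
Definition sneg Z : {set 'I_n} := [set i | (true, i) \in Z].
Definition ssupp Z : {set 'I_n} := spos Z :|: sneg Z.
Definition sopp Z : {set bool * 'I_n} := [set (~~ p.1, p.2) | p in Z].

Definition oriented_matroid SC : Prop :=
  [/\ set0 \notin SC,
      (forall Z, Z \in SC -> [disjoint spos Z & sneg Z]),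
      (forall Z, Z \in SC -> sopp Z \in SC),
      (forall Z1 Z2, Z1 \in SC -> Z2 \in SC -> ssupp Z1 \subset ssupp Z2 ->
          Z1 = Z2 \/ Z1 = sopp Z2) &
      (forall Z1 Z2 e, Z1 \in SC -> Z2 \in SC -> Z1 != sopp Z2 ->
          e \in spos Z1 :&: sneg Z2 ->
          exists2 Z3, Z3 \in SC &
            (spos Z3 \subset (spos Z1 :|: spos Z2) :\ e) /\
            (sneg Z3 \subset (sneg Z1 :|: sneg Z2) :\ e))].

Definition underlying SC : {set {set 'I_n}} := [set ssupp Z | Z in SC].

Definition signed_perm (g : {perm bool * 'I_n}) : Prop :=
  forall b i, g (~~ b, i) = (~~ (g (b, i)).1, (g (b, i)).2).

Definition om_aut SC (g : {perm bool * 'I_n}) : Prop :=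
  signed_perm g /\ forall Z, (g @: Z \in SC) = (Z \in SC).

Definition sp_map (g : {perm bool * 'I_n}) (i : 'I_n) : 'I_n := (g (false, i)).2.

End Matroid.

(* Graded pieces of quotients of the tensor algebra T(V), V = k^n          *)
(* (basis x_1..x_n, or y_1..y_n for Koszul duals).                         *)
(* Degree d piece of T(V): functions on words of length d.                 *)
Section Tensor.
Variables (K : fieldType) (n : nat).

Definition tens (d : nat) := {ffun d.-tuple 'I_n -> K^o}.

(* homogeneous noncommutative polynomials as formal lists (coeff, word) *)
Definition fpoly := seq (K * seq 'I_n).

Definition embed (d : nat) (p : fpoly) : tens d :=
  [ffun t : d.-tuple 'I_n => \sum_(cw <- p | cw.2 == val t) cw.1].

Definition fins (u : seq 'I_n) (p : fpoly) (w : seq 'I_n) : fpoly :=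
  [seq (cw.1, u ++ cw.2 ++ w) | cw <- p].

Definition span_mem (d : nat) (P : tens d -> Prop) (v : tens d) : Prop :=
  forall U : {vspace tens d}, (forall x, P x -> x \in U) -> v \in U.

Definition gsub := forall d : nat, tens d -> Prop.

Definition ideal_mem (Rels : fpoly -> Prop) : gsub := fun d =>
  span_mem (fun x => exists r u w, Rels r /\ x = embed d (fins u r w)).

(* the module X (x) Q(-1), where X = k[E_r] (basis t_j, j in E_r = E \ F)
   and Q = T(V)/(Rels): degree-d piece is spanned by t_j (x) (word of
   length d-1); encoded as words j :: w of length d. *)
Definition XshiftB (F : {set 'I_n}) (Rels : fpoly -> Prop) : gsub := fun d =>
  span_mem (fun x =>
    x = embed d [:: (1, [::])]
    \/ (exists j w, j \in F /\ x = embed d [:: (1, j :: w)])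
    \/ (exists r j u w, Rels r /\ x = embed d (fins (j :: u) r w))).

(* action of a (signed) permutation x_i |-> eps_i x_{s i} on tens d *)
Definition act (s : 'I_n -> 'I_n) (eps : 'I_n -> K) (d : nat) (v : tens d)
  : tens d :=
  [ffun t : d.-tuple 'I_n =>
     \sum_(w : d.-tuple 'I_n | map_tuple s w == t)
        (\prod_(i <- w) eps i) * v w].

(* Short exact sequence 0 -> Q1 -> Q2 -> Q3 -> 0 of graded modules over the
   group given by [acts], where Qk = T(V)/Uk degreewise.  Linear maps between
   quotients are represented by lifts to the ambient spaces. *)
Definition ses (acts : ('I_n -> 'I_n) * ('I_n -> K) -> Prop)
  (U1 U2 U3 : gsub) : Prop :=
  forall d : nat, exists (f g : {linear tens d -> tens d}),
    [/\ (forall v, U1 d v -> U2 d (f v)),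
        (forall v, U2 d (f v) -> U1 d v),
        (forall v, U2 d v -> U3 d (g v)),
        (forall z, exists v, U3 d (g v - z))
      & [/\ (forall v, U3 d (g (f v))),
        (forall v, U3 d (g v) -> exists u, U2 d (v - f u))
      & (forall h, acts h -> forall v,
          U2 d (act h.1 h.2 (f v) - f (act h.1 h.2 v)) /\
          U3 d (act h.1 h.2 (g v) - g (act h.1 h.2 v)))]].

(* Koszul dual (quadratic dual) relations of the algebra generated by
   x_i (i in S) with relations Rels (x_i, i notin S, are killed):
   y_i (i notin S) and the orthogonal of I_2 inside span of S-words. *)
Definition koszul_rels (Rels : fpoly -> Prop) (S : {set 'I_n}) (r : fpoly)
  : Prop :=
  (exists i, i \notin S /\ r = [:: (1, [:: i])])
  \/ exists phi : tens 2,
      [/\ (forall t : 2.-tuple 'I_n, phi t != 0 -> all (mem S) t),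
          (forall psi, ideal_mem Rels psi ->
             \sum_(t : 2.-tuple 'I_n) phi t * psi t = 0) &
          r = [seq (phi t, val t) | t <- enum {: 2.-tuple 'I_n}]].

Definition rem_at (k : nat) (s : seq 'I_n) := take k s ++ drop k.+1 s.

Definition sorted_enum (X : {set 'I_n}) : seq 'I_n :=
  sort (fun a b : 'I_n => (a <= b)%N) (enum X).

Definition dOS (X : {set 'I_n}) : fpoly :=
  let s := sorted_enum X in
  [seq ((-1) ^+ k, rem_at k s) | k <- iota 0 (size s)].

(* Orlik-Solomon algebra of M|_S as T(V)/(x_i (i notin S), exterior rels,
   d x_C for circuits C in S) *)
Definition OS_rels (C : {set {set 'I_n}}) (S : {set 'I_n}) (r : fpoly) : Prop :=
  [\/ exists i, i \notin S /\ r = [:: (1, [:: i])],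
      exists i j, [/\ i \in S, j \in S & r = [:: (1, [:: i; j]); (1, [:: j; i])]],
      exists i, i \in S /\ r = [:: (1, [:: i; i])] |
      exists X, [/\ X \in C, X \subset S & r = dOS X]].

Definition dVG (Z : {set bool * 'I_n}) : fpoly :=
  let s := sorted_enum (ssupp Z) in
  [seq (if c \in spos Z then 1 else -1, rem c s) | c <- s].

(* Varchenko-Gelfand ring of \cal M|_S as T(V)/(x_i (i notin S),
   commutativity, x_i^2, d^{+-} x_C for signed circuits in S) *)
Definition VG_rels (SC : {set {set bool * 'I_n}}) (S : {set 'I_n}) (r : fpoly)
  : Prop :=
  [\/ exists i, i \notin S /\ r = [:: (1, [:: i])],
      exists i j, [/\ i \in S, j \in S & r = [:: (1, [:: i; j]); (-1, [:: j; i])]],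
      exists i, i \in S /\ r = [:: (1, [:: i; i])] |
      exists Z, [/\ Z \in SC, ssupp Z \subset S & r = dVG Z]].

Definition perm_acts (G : {set {perm 'I_n}}) (F : {set 'I_n})
  (h : ('I_n -> 'I_n) * ('I_n -> K)) : Prop :=
  exists2 g, (g \in G) && (g @: F == F) & h = (fun i => g i, fun _ => 1).

Definition sperm_acts (G : {set {perm bool * 'I_n}}) (F : {set 'I_n})
  (h : ('I_n -> 'I_n) * ('I_n -> K)) : Prop :=
  exists2 g, (g \in G) && ([set sp_map g i | i in F] == F) &
    h = (sp_map g, fun i => if (g (false, i)).1 then -1 else 1).

End Tensor.

(* Main.v *)
(* Both sequences are proved dually, through functionals on words. Signed
   circuits with a sign q and q-commuting variables treat the Orlik-Solomon
   algebra (q = -1, all signs 1) and the Varchenko-Gelfand ring (q = 1) together.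
   For j <> k off the modular hyperplane F, the line through j and k meets F in
   one point i, so x_j x_k is a combination of x_j x_i and x_i x_k; by circuit
   elimination these relations, together with those of the circuits in F, imply
   all others. Hence A = B + sum_j x_j B, and the sum is direct because each j off
   F has a residue map A -> B: extract x_j and specialise the other variables by
   x_k |-> +-x_i, which is the projection to the contraction of j.
   Dually, y_i y_j with i in F and j off F can be rewritten into words starting
   off F. That this straightening respects the relations of A^! (so that left
   multiplication X (x) A^! -> A^! is injective) follows from the existence of the
   residues. *)

(* Functionals on words make every statement about ideals an equation that can be checked letter by
   letter, at any position of a word, without choosing a basis of a quotient. For the Koszul dual
   this is decisive: the degree-2 relations of A^! are the degree-2 functionals on A, so whatever
   produces functionals on A, residues above all, produces relations of A^!. The obstacle is the
   injectivity in (ii), since straightening must respect relations that are known only as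
   annihilators. Pairing such a functional phi with two straightening steps yields residues of phi,
   which live in degree 3; contracting their first letter gives degree-2 functionals on A again,
   hence relations that already hold. Equivariance needs maps free of choices. Residues use only the
   points of F on lines and products of two signs of one circuit, so neither an order on E nor the
   choice of a signed circuit on each support matters. Signs are kept as elements of K of square 1,
   which treats all characteristics alike. *)
Require Import Defs.
From HB Require Import structures.
From mathcomp Require Import all_boot all_order all_fingroup all_algebra.
From mathcomp Require Import ring.
From Stdlib Require Import Classical.
Import GRing.Theory.
Local Open Scope ring_scope.

(** * Subspaces and separating functionals *)

Section LinearAlgebra.
Set Implicit Arguments. Unset Strict Implicit. Unset Printing Implicit Defensive.

(** [U] grows inside [P] by one vector at a time until it exhausts [P]; [m] bounds the codimension
    still available. This turns graded pieces, which are mere predicates, into subspaces. *)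
Lemma vspace_of_pred (K : fieldType) (vT : vectType K) (P : vT -> Prop) :
  P 0 -> (forall a x y, P x -> P y -> P (a *: x + y)) ->
  exists U : {vspace vT}, forall v, P v <-> v \in U.
Proof.
move=> P0 Plin.
suff H m (U : {vspace vT}) : (forall v, v \in U -> P v) ->
    (\dim {: vT} <= \dim U + m)%N ->
    exists U : {vspace vT}, forall v, P v <-> v \in U.
  apply: (H (\dim {: vT}) 0%VS); last by rewrite leq_addl.
  by move=> v; rewrite memv0 => /eqP ->.
elim: m U => [|m IH] U UP dU.
  exists U => v; split=> [_|]; last exact: UP.
  have -> : U = fullv.
    by apply/eqP; rewrite eqEdim subvf -(addn0 (\dim U)).
  exact: memvf.
have [[x [Px xU]]|noex] := classic (exists x, P x /\ x \notin U); last first.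
  exists U => v; split=> [Pv|]; last exact: UP.
  by apply/negPn/negP => vU; apply: noex; exists v.
apply: (IH (<[x]> + U)%VS).
  move=> v /memv_addP [_ /vlineP [a ->] [u uU ->]].
  by apply: Plin => //; apply: UP.
apply: leq_trans dU _; rewrite addnS -addSn leq_add2r.
rewrite ltnNge; apply: contra xU => le.
have /eqP -> : U == (<[x]> + U)%VS by rewrite eqEdim addvSr.
by rewrite (subvP (addvSl _ _)) // memv_line.
Qed.

Variables (K : fieldType) (I : finType).
Implicit Types (u v : {ffun I -> K^o}) (U : {vspace {ffun I -> K^o}}).

(** The functional is a coordinate, nonzero at [v], of the identity minus the projection onto
    [U]. *)
Lemma separating_functional U v : v \notin U ->
  exists2 psi : {ffun I -> K^o}, (forall u, u \in U -> \sum_t u t * psi t = 0)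
    & \sum_t v t * psi t != 0.
Proof.
move=> vU; pose L := (\1 - projv U)%VF.
have LE u : L u = u - projv U u by rewrite add_lfunE opp_lfunE id_lfunE.
have Lv : L v != 0.
  rewrite LE subr_eq0; apply: contra vU => /eqP ->.
  exact: memv_proj.
have [t Lt] : exists t, L v t != 0.
  apply/existsP; apply: contraNT Lv => /existsPn H.
  by apply/eqP/ffunP => t; rewrite ffunE; have := H t; rewrite negbK => /eqP.
pose e t' : {ffun I -> K^o} := [ffun s => (s == t')%:R].
pose psi : {ffun I -> K^o} := [ffun t' => L (e t') t].
have psiE u : \sum_s u s * psi s = L u t.
  have uE : u = \sum_s u s *: e s.
    apply/ffunP => s; rewrite sum_ffunE (bigD1 s) //= !ffunE eqxx.
    rewrite [X in _ + X]big1 ?addr0 => [|s' ns]; first by rewrite /GRing.scale /= mulr1.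
    by rewrite !ffunE eq_sym (negPf ns) /GRing.scale /= mulr0.
  rewrite [in RHS]uE linear_sum sum_ffunE; apply: eq_bigr => s _.
  by rewrite linearZ !ffunE.
exists psi => [u uU|]; rewrite psiE //.
by rewrite LE projv_id // subrr ffunE.
Qed.

End LinearAlgebra.

(** For identities modulo [x * x = 1] whose cofactor [c] is supplied by hand. *)
Lemma eq_mod_square (K : fieldType) (c x a b : K) :
  x * x = 1 -> a - b = (x * x - 1) * c -> a = b.
Proof. by move=> ->; rewrite subrr mul0r => /eqP; rewrite subr_eq0 => /eqP. Qed.

(** * Functionals on words, annihilators and transposed exact sequences *)

Section Duality.
Set Implicit Arguments. Unset Strict Implicit. Unset Printing Implicit Defensive.
Variables (K : fieldType) (n : nat).
Implicit Types (p r : fpoly K n) (u w : seq 'I_n) (psi chi : seq 'I_n -> K).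

Definition ev p psi : K := \sum_(x <- p) x.1 * psi x.2.

Definition homog (d : nat) p : bool := all (fun x => size x.2 == d) p.

Definition dot (d : nat) (v : tens K n d) psi : K :=
  \sum_(t : d.-tuple 'I_n) (v t : K) * psi t.

Definition tr (L : seq 'I_n -> fpoly K n) psi w : K := ev (L w) psi.

Lemma ev_nil psi : ev [::] psi = 0.
Proof. by rewrite /ev big_nil. Qed.

Lemma ev_cons x p psi : ev (x :: p) psi = x.1 * psi x.2 + ev p psi.
Proof. by rewrite /ev big_cons. Qed.

Lemma ev_cat p p' psi : ev (p ++ p') psi = ev p psi + ev p' psi.
Proof. by rewrite /ev big_cat. Qed.

Definition ev_simpl := (ev_nil, ev_cons, addr0).

Lemma ev_fins u r w psi : ev (fins u r w) psi = ev r (fun z => psi (u ++ z ++ w)).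
Proof. by rewrite /ev /fins big_map. Qed.

Lemma ev_prefix a c p psi :
  ev [seq (a * x.1, c :: x.2) | x <- p] psi = a * ev p (fun y => psi (c :: y)).
Proof.
by rewrite /ev big_map mulr_sumr; apply: eq_bigr => x _; rewrite mulrA.
Qed.

Lemma eq_ev p psi chi : psi =1 chi -> ev p psi = ev p chi.
Proof. by move=> E; apply: eq_bigr => x _; rewrite E. Qed.

Lemma eq_in_ev d p psi chi : homog d p ->
  (forall w, size w = d -> psi w = chi w) -> ev p psi = ev p chi.
Proof.
move=> /allP hp E; rewrite /ev !big_seq.
by apply: eq_bigr => x /hp /eqP /E ->.
Qed.

Lemma ev0 p : ev p (fun=> 0) = 0.
Proof. by rewrite /ev big1 // => x _; rewrite mulr0. Qed.

Lemma evZ p a psi : ev p (fun w => a * psi w) = a * ev p psi.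
Proof. by rewrite /ev mulr_sumr; apply: eq_bigr => x _; rewrite mulrCA. Qed.

Lemma evD p psi chi : ev p (fun w => psi w + chi w) = ev p psi + ev p chi.
Proof. by rewrite /ev -big_split; apply: eq_bigr => x _; rewrite mulrDr. Qed.

Lemma ev_sum p (J : finType) (P : pred J) (F : J -> seq 'I_n -> K) :
  ev p (fun w => \sum_(j | P j) F j w) = \sum_(j | P j) ev p (F j).
Proof.
rewrite /ev exchange_big; apply: eq_bigr => x _.
by rewrite mulr_sumr.
Qed.

Lemma evC p p' (M : seq 'I_n -> seq 'I_n -> K) :
  ev p (fun w => ev p' (fun w' => M w w')) =
  ev p' (fun w' => ev p (fun w => M w w')).
Proof.
rewrite /ev; under eq_bigr do rewrite mulr_sumr.
rewrite exchange_big; apply: eq_bigr => x _; rewrite mulr_sumr.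
by apply: eq_bigr => y _; rewrite mulrCA.
Qed.

Lemma dotD d (v v' : tens K n d) psi : dot (v + v') psi = dot v psi + dot v' psi.
Proof.
by rewrite /dot -big_split; apply: eq_bigr => t _; rewrite ffunE mulrDl.
Qed.

Lemma dotZ d a (v : tens K n d) psi : dot (a *: v) psi = a * dot v psi.
Proof.
by rewrite /dot mulr_sumr; apply: eq_bigr => t _; rewrite ffunE -mulrA.
Qed.

Lemma dotB d (v v' : tens K n d) psi : dot (v - v') psi = dot v psi - dot v' psi.
Proof. by rewrite dotD -scaleN1r dotZ mulN1r. Qed.

Lemma dot0 d psi : dot (0 : tens K n d) psi = 0.
Proof. by rewrite /dot big1 // => t _; rewrite ffunE mul0r. Qed.

Lemma dot_sum d (J : finType) (F : J -> tens K n d) psi :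
  dot (\sum_j F j) psi = \sum_j dot (F j) psi.
Proof.
rewrite /dot exchange_big; apply: eq_bigr => t _ /=.
by rewrite sum_ffunE mulr_suml.
Qed.

Lemma eq_in_dot d (v : tens K n d) psi chi :
  (forall w, size w = d -> psi w = chi w) -> dot v psi = dot v chi.
Proof. by move=> E; apply: eq_bigr => t _; rewrite E ?size_tuple. Qed.

Lemma dot_embed d p psi : homog d p -> dot (embed d p) psi = ev p psi.
Proof.
move=> /allP hp; rewrite /dot /ev.
under eq_bigr => t _ do rewrite ffunE mulr_suml big_mkcond.
rewrite exchange_big big_seq [RHS]big_seq; apply: eq_bigr => x /hp sx /=.
rewrite (bigD1 (Tuple sx)) //= eqxx big1 ?addr0 // => t nt.
by case: eqP => // E; case/eqP: nt; apply: val_inj.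
Qed.

Lemma embed_homog d e p : homog e p -> e != d -> embed d p = 0.
Proof.
move=> /allP hp ne; apply/ffunP => t; rewrite !ffunE big_seq_cond big1 // => x.
case/andP=> /hp /eqP sx /eqP E; case/eqP: ne.
by rewrite -sx E size_tuple.
Qed.

(** Extension by zero to words of other lengths, so that one predicate on functions of all words
    describes the annihilators in every degree. *)
Definition extf d (psi : tens K n d) w : K :=
  if insub w is Some t then psi t else 0.

Lemma extf_tuple d (psi : tens K n d) (t : d.-tuple 'I_n) : extf psi t = psi t.
Proof. by rewrite /extf valK. Qed.

Lemma extf_size d (psi : tens K n d) w : size w != d -> extf psi w = 0.
Proof. by move=> H; rewrite /extf insubN. Qed.

Lemma dot_extf d (v psi : tens K n d) :
  dot v (extf psi) = \sum_t (v t : K) * psi t.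
Proof. by apply: eq_bigr => t _; rewrite extf_tuple. Qed.

(* [dualpair U N]: degreewise, U is a subspace and N is its annihilator. *)
Definition dualpair (U : gsub K n) (N : (seq 'I_n -> K) -> Prop) : Prop :=
  [/\ forall d (v : tens K n d) psi, U d v -> N psi -> dot v psi = 0,
      forall d (psi : tens K n d),
        (forall v, U d v -> dot v (extf psi) = 0) -> N (extf psi) &
      forall d, exists V : {vspace tens K n d}, forall v, U d v <-> v \in V].

(** Double annihilator in finite dimension: a vector outside the subspace would be separated from it
    by a functional belonging to [N]. *)
Lemma dualpair_mem U N d (v : tens K n d) : dualpair U N ->
  (forall psi, N psi -> dot v psi = 0) -> U d v.
Proof.
case=> _ UN /(_ d) [V VU] vN; apply/VU; apply/negPn/negP.
case/separating_functional => psi psiV /eqP; apply.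
rewrite -dot_extf; apply: vN; apply: UN => u /VU uV.
by rewrite dot_extf psiV.
Qed.

Lemma dualpair_iff U N N' : dualpair U N -> (forall psi, N psi <-> N' psi) ->
  dualpair U N'.
Proof.
case=> h1 h2 h3 E; split=> // [d v psi Uv /E|d psi /h2 /E //].
exact: h1.
Qed.

Lemma span_memW d (P : tens K n d -> Prop) v : P v -> span_mem P v.
Proof. by move=> Pv U; apply. Qed.

(** Generators of a degree other than [d] are harmless: [embed] sends them to 0, and a functional
    extended by zero vanishes on them. *)
Lemma span_dualpair (P : gsub K n) (Gen : fpoly K n -> Prop) :
  (forall d x, P d x <-> exists2 p, Gen p & x = embed d p) ->
  (forall p, Gen p -> exists d, homog d p) ->
  dualpair (fun d => span_mem (P d)) (fun psi => forall p, Gen p -> ev p psi = 0).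
Proof.
move=> PE hG; split=> [d v psi + Npsi|d psi Hpsi p Gp|d].
- pose f (x : tens K n d) : K^o := dot x psi.
  have lf : linear f by move=> a x y; rewrite /f dotD dotZ.
  pose F := GRing.isLinear.Build K (tens K n d) K^o *:%R f lf.
  pose fl : {linear tens K n d -> K^o} := HB.pack f F.
  move=> /(_ (lker (linfun fl))); rewrite memv_ker lfunE => H.
  apply/eqP/H => x /PE [p Gp ->]; rewrite memv_ker lfunE /= /f.
  have [e he] := hG p Gp.
  case: (eqVneq e d) he => [-> he|ne he]; first by rewrite dot_embed ?Npsi.
  by rewrite (embed_homog he ne) dot0.
- have [e he] := hG p Gp.
  case: (eqVneq e d) he => [-> he|ne he].
    rewrite -(dot_embed _ he); apply: Hpsi; apply: span_memW.
    by apply/PE; exists p.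
  rewrite (@eq_in_ev e _ _ (fun=> 0)) ?ev0 // => w sw.
  by rewrite extf_size // sw.
- apply: vspace_of_pred => [U _|a x y Px Py U PU]; first exact: mem0v.
  by rewrite memvD ?memvZ ?Px ?Py.
Qed.

Definition ann (Rels : fpoly K n -> Prop) psi : Prop :=
  forall r, Rels r -> forall u w, ev r (fun z => psi (u ++ z ++ w)) = 0.

Lemma homog_fins d u r w : homog d r -> homog (size u + d + size w) (fins u r w).
Proof.
move=> /allP h; apply/allP => x /mapP [y /h /eqP sy ->] /=.
by rewrite !size_cat sy addnA.
Qed.

Lemma ideal_dualpair (Rels : fpoly K n -> Prop) :
  (forall r, Rels r -> exists d, homog d r) ->
  dualpair (ideal_mem Rels) (ann Rels).
Proof.
move=> hR; apply: (@dualpair_iff _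
   (fun psi => forall p, (exists r u w, Rels r /\ p = fins u r w) -> ev p psi = 0)).
  apply: span_dualpair => [d x|p [r [u [w [/hR [d hr] ->]]]]].
    split=> [[r [u [w [Rr ->]]]]|[_ [r [u [w [Rr ->]]]] ->]].
      by exists (fins u r w) => //; exists r, u, w.
    by exists r, u, w.
  by eexists; apply: homog_fins hr.
move=> psi; split=> [H r Rr u w|H _ [r [u [w [Rr ->]]]]].
  by rewrite -ev_fins H //; exists r, u, w.
by rewrite ev_fins H.
Qed.

Lemma shift_dualpair (F : {set 'I_n}) (Rels : fpoly K n -> Prop) N :
  (forall r, Rels r -> exists d, homog d r) ->
  (forall psi, ann Rels psi <-> N psi) ->
  dualpair (XshiftB F Rels) (fun psi =>
    [/\ psi [::] = 0, forall j w, j \in F -> psi (j :: w) = 0 &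
        forall j, N (fun w => psi (j :: w))]).
Proof.
move=> hR NE; pose Gen (p : fpoly K n) := p = [:: (1, [::])]
    \/ (exists j w, j \in F /\ p = [:: (1, j :: w)])
    \/ (exists r j u w, Rels r /\ p = fins (j :: u) r w).
apply: (@dualpair_iff _ (fun psi => forall p, Gen p -> ev p psi = 0)).
  apply: span_dualpair => [d x|p].
    split=> [|[p [->|[[j [w [jF ->]]]|[r [j [u [w [Rr ->]]]]]]] ->]].
    - case=> [->|[[j [w [jF ->]]]|[r [j [u [w [Rr ->]]]]]]].
      + by exists [:: (1, [::])] => //; left.
      + by exists [:: (1, j :: w)] => //; right; left; exists j, w.
      + by exists (fins (j :: u) r w) => //; right; right; exists r, j, u, w.
    - by left.
    - by right; left; exists j, w.
    - by right; right; exists r, j, u, w.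
  case=> [->|[[j [w [jF ->]]]|[r [j [u [w [/hR [d hr] ->]]]]]]].
  - by exists 0%N.
  - by exists (size w).+1; rewrite /homog /= eqxx.
  - by eexists; apply: homog_fins hr.
move=> psi; split=> [H|[h0 h1 h2] p].
  split=> [|j w jF|j].
  - by have := H _ (or_introl erefl); rewrite !ev_simpl mul1r.
  - have := H [:: (1, j :: w)]; rewrite !ev_simpl mul1r; apply.
    by right; left; exists j, w.
  - apply/NE => r Rr u w.
    rewrite -(H (fins (j :: u) r w)) ?ev_fins //.
    by right; right; exists r, j, u, w.
case=> [->|[[j [w [jF ->]]]|[r [j [u [w [Rr ->]]]]]]].
- by rewrite !ev_simpl h0 mulr0.
- by rewrite !ev_simpl h1 ?mulr0.
- by rewrite ev_fins; move/NE: (h2 j); apply.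
Qed.

Definition lenpres (L : seq 'I_n -> fpoly K n) := forall w, homog (size w) (L w).

Definition wmap (L : seq 'I_n -> fpoly K n) d (v : tens K n d) : tens K n d :=
  \sum_(t : d.-tuple 'I_n) (v t : K) *: embed d (L t).

Fact wmap_is_linear L d : linear (@wmap L d).
Proof.
move=> a x y; rewrite /wmap scaler_sumr -big_split; apply: eq_bigr => t _.
by rewrite !ffunE scalerDl scalerA.
Qed.

HB.instance Definition _ L d :=
  GRing.isLinear.Build K (tens K n d) (tens K n d) _ (@wmap L d) (@wmap_is_linear L d).

Lemma dot_wmap L d (v : tens K n d) psi : lenpres L ->
  dot (wmap L v) psi = dot v (tr L psi).
Proof.
move=> hL; rewrite dot_sum; apply: eq_bigr => t _.
by rewrite dotZ dot_embed // -{1}(size_tuple t).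
Qed.

Definition actT (h : ('I_n -> 'I_n) * ('I_n -> K)) psi w : K :=
  (\prod_(i <- w) h.2 i) * psi (map h.1 w).

Lemma dot_act h d (v : tens K n d) psi :
  dot (Defs.act h.1 h.2 v) psi = dot v (actT h psi).
Proof.
rewrite /dot.
under eq_bigr => t _ do rewrite ffunE mulr_suml big_mkcond.
rewrite exchange_big; apply: eq_bigr => w _ /=.
rewrite (bigD1 (map_tuple h.1 w)) //= eqxx [X in _ + X]big1 ?addr0 => [|t nt].
  by rewrite /actT -mulrA mulrCA.
  by rewrite eq_sym (negPf nt).
Qed.

(** Exactness is read off the transposes: extending functionals from [N1] to [N2] gives injectivity,
    the section [Lk] gives surjectivity, and the middle is exact because a functional on Q2 that
    kills the image of Q1 comes from Q3. *)
Lemma ses_dual (acts : ('I_n -> 'I_n) * ('I_n -> K) -> Prop)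
    (U1 U2 U3 : gsub K n) N1 N2 N3 Lf Lg Lk :
  dualpair U1 N1 -> dualpair U2 N2 -> dualpair U3 N3 ->
  lenpres Lf -> lenpres Lg -> lenpres Lk ->
  (forall psi, N2 psi -> N1 (tr Lf psi)) ->
  (forall chi, N1 chi -> exists2 psi, N2 psi & tr Lf psi =1 chi) ->
  (forall psi, N3 psi -> N2 (tr Lg psi)) ->
  (forall psi, N3 psi -> tr Lk (tr Lg psi) =1 psi) ->
  (forall psi, N3 psi -> tr Lf (tr Lg psi) =1 (fun=> 0)) ->
  (forall psi, N2 psi -> tr Lf psi =1 (fun=> 0) ->
     exists2 chi, N3 chi & tr Lg chi =1 psi) ->
  (forall h psi, acts h -> N2 psi -> tr Lf (actT h psi) =1 actT h (tr Lf psi)) ->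
  (forall h psi, acts h -> N3 psi -> tr Lg (actT h psi) =1 actT h (tr Lg psi)) ->
  ses acts U1 U2 U3.
Proof.
move=> D1 D2 D3 hf hg hk H1 H2 H3 H4 H5 H6 H7 H8 d.
have [E1 _ _] := D1; have [E2 A2 V2] := D2; have [E3 _ _] := D3.
exists (@wmap Lf d), (@wmap Lg d); split.
- move=> v Uv; apply: (dualpair_mem D2) => psi Npsi.
  by rewrite dot_wmap // (E1 _ _ _ Uv) //; apply: H1.
- move=> v Uv; apply: (dualpair_mem D1) => chi /H2 [psi Npsi E].
  by rewrite -(@eq_in_dot _ _ (tr Lf psi)) // -dot_wmap // (E2 _ _ _ Uv).
- move=> v Uv; apply: (dualpair_mem D3) => psi Npsi.
  by rewrite dot_wmap // (E2 _ _ _ Uv) //; apply: H3.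
- move=> z; exists (wmap Lk z); apply: (dualpair_mem D3) => psi Npsi.
  rewrite dotB !dot_wmap // (@eq_in_dot _ _ _ psi) ?subrr // => w _.
  exact: H4.
split.
- move=> v; apply: (dualpair_mem D3) => psi Npsi.
  rewrite !dot_wmap // (@eq_in_dot _ _ _ (fun=> 0)) => [|w _]; last exact: H5.
  by rewrite /dot big1 // => t _; rewrite mulr0.
- move=> v Uv; have [V VU] := V2 d.
  suff: v \in (V + limg (linfun (@wmap Lf d)))%VS.
    case/memv_addP => x xV [y /memv_imgP [u _ ->] ->].
    by exists u; rewrite lfunE /= addrK; apply/VU.
  apply/negPn/negP => /separating_functional [psi psi0 /eqP]; apply.
  have N2psi : N2 (extf psi).
    apply: A2 => x /VU xV; rewrite dot_extf psi0 //.
    exact: (subvP (addvSl _ _)).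
  case: (H6 _ N2psi) => [w|chi Nchi E].
    (* [Lf] preserves length, so only words of length [d] can meet the support of [extf psi]. *)
    case: (eqVneq (size w) d) => [|sw]; last first.
      rewrite /tr (@eq_in_ev (size w) _ _ (fun=> 0)) ?ev0 // => z sz.
      by rewrite extf_size // sz.
    move/eqP => sw; rewrite /tr -(dot_embed _ (p := Lf w) (d := d)); last first.
      by rewrite -{1}(eqP sw).
    rewrite dot_extf psi0 //; apply: (subvP (addvSr _ _)).
    have -> : embed d (Lf w) = wmap Lf ([ffun s => (s == Tuple sw)%:R] : tens K n d).
      rewrite /wmap (bigD1 (Tuple sw)) //= ffunE eqxx scale1r big1 ?addr0 // => s ns.
      by rewrite ffunE (negPf ns) scale0r.
    by rewrite -[X in X \in _]lfunE memv_img ?memvf.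
  rewrite -dot_extf -(@eq_in_dot _ _ (tr Lg chi)) // -dot_wmap //.
  exact: E3 Nchi.
- move=> h ah v; split.
    apply: (dualpair_mem D2) => psi Npsi.
    rewrite dotB dot_act !dot_wmap // dot_act (@eq_in_dot _ _ _ (actT h (tr Lf psi))).
      by rewrite subrr.
    by move=> w _; apply: H7.
  apply: (dualpair_mem D3) => psi Npsi.
  rewrite dotB dot_act !dot_wmap // dot_act (@eq_in_dot _ _ _ (actT h (tr Lg psi))).
    by rewrite subrr.
  by move=> w _; apply: H8.
Qed.

Lemma sum_pairs (g : seq 'I_n -> K) :
  \sum_(t : 2.-tuple 'I_n) g t = \sum_a \sum_b g [:: a; b].
Proof.
rewrite pair_bigA /=.
rewrite (reindex (fun p : 'I_n * 'I_n => [tuple p.1; p.2])) //=.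
exists (fun t => (tnth t ord0, tnth t (lift ord0 ord0))) => [[a b] _|t _] //.
by case: t => [[|a [|b []]]] //= i; apply: val_inj.
Qed.

Lemma koszul_rels_homog (R : fpoly K n -> Prop) S r :
  koszul_rels R S r -> exists d, homog d r.
Proof.
case=> [[i [_ ->]]|[phi [_ _ ->]]]; first by exists 1%N.
by exists 2%N; apply/allP => x /mapP [t _ ->]; rewrite /= size_tuple.
Qed.

Lemma ev_koszul (phi : tens K n 2) psi :
  ev [seq (phi t : K, val t) | t <- enum {: 2.-tuple 'I_n}] psi =
  \sum_a \sum_b extf phi [:: a; b] * psi [:: a; b].
Proof.
rewrite -(sum_pairs (fun w => extf phi w * psi w)) /ev big_map big_enum.
by apply: eq_bigr => t _; rewrite extf_tuple.
Qed.

(** The quadratic relations of the dual are the functionals on degree 2, so annihilating them is a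
    condition on two adjacent letters at every position. *)
Lemma ann_koszul (R : fpoly K n -> Prop) (S : {set 'I_n}) N psi :
  dualpair (ideal_mem R) N ->
  ann (koszul_rels R S) psi <->
  (forall u i w, i \notin S -> psi (u ++ i :: w) = 0) /\
  (forall u w phi, N phi ->
     (forall a b, phi [:: a; b] != 0 -> (a \in S) && (b \in S)) ->
     \sum_a \sum_b phi [:: a; b] * psi (u ++ a :: b :: w) = 0).
Proof.
move=> D; have [DU DN _] := D; split=> [H|[H1 H2] r Rr u w].
  split=> [u i w iS|u w phi Nphi phiS].
    have := H [:: (1, [:: i])] (or_introl (ex_intro _ i (conj iS erefl))) u w.
    by rewrite !ev_simpl mul1r.
  (* Only the values of [phi] on words of length two enter; the others are cut off. *)
  pose phi2 : tens K n 2 := [ffun t : 2.-tuple 'I_n => (phi t : K^o)].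
  have E a b : extf phi2 [:: a; b] = phi [:: a; b].
    by rewrite (extf_tuple phi2 [tuple a; b]) ffunE.
  have := H [seq (phi2 t : K, val t) | t <- enum {: 2.-tuple 'I_n}].
  move=> /(_ _ u w); rewrite ev_koszul => {}H.
  rewrite -[RHS]H.
    by apply: eq_bigr => a _; apply: eq_bigr => b _; rewrite E.
  right; exists phi2; split=> // [t|v Uv].
    rewrite ffunE; case: t => [[|a [|b []]]] //= i.
    by move/phiS => /andP [-> ->].
  rewrite -[RHS](DU 2 v phi Uv Nphi) /dot; apply: eq_bigr => t _.
  by rewrite ffunE mulrC.
case: Rr => [[i [iS ->]]|[phi [phiS phi0 ->]]].
  by rewrite !ev_simpl /= H1 ?mulr0.
rewrite ev_koszul; apply: H2.
  apply: DN => v Uv; rewrite dot_extf -[RHS](phi0 v Uv).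
  by apply: eq_bigr => t _; rewrite mulrC.
move=> a b; rewrite (extf_tuple phi [tuple a; b]) => /phiS.
by rewrite /= andbT.
Qed.

End Duality.

(** * Residues and the first exact sequence *)

Section Residue.
Set Implicit Arguments. Unset Strict Implicit. Unset Printing Implicit Defensive.
Variables (K : fieldType) (n : nat) (F : {set 'I_n}) (q : K).
Variables (pi : 'I_n -> 'I_n -> 'I_n) (al : 'I_n -> 'I_n -> K).
Variable Q : fpoly K n -> Prop.
Implicit Types (u w z : seq 'I_n) (psi chi : seq 'I_n -> K) (i j k l c : 'I_n).

Definition qcomm psi : Prop :=
  (forall u a b w, psi (u ++ a :: b :: w) = q * psi (u ++ b :: a :: w)) /\
  (forall u a w, psi (u ++ a :: a :: w) = 0).

Definition triangle_rel psi : Prop := forall u w j k,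
  j \notin F -> k \notin F -> j != k ->
  psi (u ++ j :: k :: w) = al j k * psi (u ++ j :: pi j k :: w)
                           + al k j * psi (u ++ pi j k :: k :: w).

Definition offF psi : Prop := forall w, ~~ all (mem F) w -> psi w = 0.

Definition annA psi : Prop := [/\ qcomm psi, triangle_rel psi & ann Q psi].
Definition annB psi : Prop := [/\ offF psi, qcomm psi & ann Q psi].
Definition annX chi : Prop :=
  [/\ chi [::] = 0, forall j w, j \in F -> chi (j :: w) = 0 &
      forall j, annB (fun w => chi (j :: w))].

Hypothesis q2 : q * q = 1.
Hypothesis pi_id : forall j i, i \in F -> pi j i = i.
Hypothesis al_id : forall j i, i \in F -> al j i = 1.
Hypothesis al_diag : forall j, j \notin F -> al j j = 0.
Hypothesis pi_in : forall j k, j \notin F -> k \notin F -> j != k -> pi j k \in F.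
Hypothesis pi_sym : forall j k, j \notin F -> k \notin F -> j != k -> pi j k = pi k j.
(** Length at least two leaves degree one free of relations, which [annB_delta] relies on. *)
Hypothesis Q_homog : forall r, Q r -> exists d, homog d.+2 r.
Hypothesis QF : forall r, Q r -> all (fun x => all (mem F) x.2) r.
(** This is the image of the triangle relation of k and l under the specialisation along j; it makes
    that specialisation well defined on A. *)
Hypothesis plane_rel : forall chi, annB chi -> forall u w j k l,
  j \notin F -> k \notin F -> l \notin F -> j != k -> j != l -> k != l ->
  al j k * al j l * chi (u ++ pi j k :: pi j l :: w) =
  al k l * al j k * chi (u ++ pi j k :: pi k l :: w) +
  al l k * al j l * chi (u ++ pi k l :: pi j l :: w).

Lemma eq_ev_Q r psi chi : Q r ->
  (forall w, all (mem F) w -> psi w = chi w) -> ev r psi = ev r chi.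
Proof.
move=> /QF /allP rF E; rewrite /ev !big_seq.
by apply: eq_bigr => x /rF /E ->.
Qed.

Lemma annA_cons psi c : annA psi -> annA (fun w => psi (c :: w)).
Proof.
case=> [[h1 h2] h3 h4]; split; first split.
- by move=> u a b w; apply: (h1 (c :: u)).
- by move=> u a w; apply: (h2 (c :: u)).
- by move=> u w j k; apply: (h3 (c :: u)).
- by move=> r Qr u w; apply: (h4 _ Qr (c :: u)).
Qed.

Lemma annB_cons psi c : annB psi -> annB (fun w => psi (c :: w)).
Proof.
case=> [h3 [h1 h2] h4]; split; last 1 first.
- by move=> r Qr u w; apply: (h4 _ Qr (c :: u)).
- by move=> w hw; apply: h3; rewrite /= negb_and hw orbT.
split; first by move=> u a b w; apply: (h1 (c :: u)).
by move=> u a w; apply: (h2 (c :: u)).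
Qed.

Lemma annB_annA psi : annB psi -> annA psi.
Proof.
case=> [h3 h1 h4]; split=> // u w j k jF kF _.
by rewrite !h3 ?mulr0 ?addr0 // all_cat /= ?(negPf jF) ?(negPf kF) ?andbF.
Qed.

Lemma annA_sub psi chi : annA psi -> annA chi -> annA (fun w => psi w - chi w).
Proof.
move=> [[h1 h2] h3 h4] [[g1 g2] g3 g4]; split; first split.
- by move=> u a b w; rewrite h1 g1 mulrBr.
- by move=> u a w; rewrite h2 g2 subrr.
- by move=> u w j k jF kF jk; rewrite h3 // g3 //; ring.
- move=> r Qr u w; have := h4 r Qr u w; have := g4 r Qr u w.
  rewrite /ev => e1 e2; under eq_bigr do rewrite mulrBr.
  by rewrite sumrB e1 e2 subrr.
Qed.

Lemma annA_sum (J : finType) (P : pred J) (psi : J -> seq 'I_n -> K) :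
  (forall x, P x -> annA (psi x)) -> annA (fun w => \sum_(x | P x) psi x w).
Proof.
move=> H; split; first split.
- move=> u a b w; rewrite mulr_sumr; apply: eq_bigr => x Px.
  by have [[-> _] _ _] := H x Px.
- by move=> u a w; rewrite big1 // => x Px; have [[_ ->] _ _] := H x Px.
- move=> u w j k jF kF jk; rewrite !mulr_sumr -big_split; apply: eq_bigr => x Px.
  by have [_ -> //] := H x Px.
- move=> r Qr u w; rewrite ev_sum big1 // => x Px.
  by have [_ _ ->] := H x Px.
Qed.

Lemma annA_ext psi chi : psi =1 chi -> annA psi -> annA chi.
Proof.
move=> E [[h1 h2] h3 h4]; split; first split.
- by move=> u a b w; rewrite -!E h1.
- by move=> u a w; rewrite -!E h2.
- by move=> u w j k jF kF jk; rewrite -!E h3.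
- by move=> r Qr u w; rewrite -[RHS](h4 r Qr u w); apply: eq_ev => z.
Qed.

(* Specialisation A -> B along j, i.e. the map to the contraction of j:
   x_c is sent to [al j c * x_(pi j c)]. *)
Definition spec j chi w : K := (\prod_(c <- w) al j c) * chi (map (pi j) w).

Lemma spec_cons j chi c w :
  spec j chi (c :: w) = al j c * spec j (fun z => chi (pi j c :: z)) w.
Proof. by rewrite /spec big_cons mulrA. Qed.

Lemma spec_F j chi w : all (mem F) w -> spec j chi w = chi w.
Proof.
move=> wF; rewrite /spec big_seq big1 ?mul1r => [|c /(allP wF)]; last exact: al_id.
by congr chi; rewrite -[RHS]map_id; apply/eq_in_map => c /(allP wF) /= /pi_id ->.
Qed.

(** The triangle relation of k and l goes to [plane_rel]. If j is k or l, then [al j j = 0] kills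
    two of the three terms and the third has a repeated letter. *)
Lemma spec_annA j chi : j \notin F -> annB chi -> annA (spec j chi).
Proof.
move=> jF Bchi; split; first split.
- move=> u a b w; rewrite /spec !map_cat /= !big_cat !big_cons /=.
  by have [_ [-> _] _] := Bchi; ring.
- move=> u a w; rewrite /spec !map_cat /=.
  by have [_ [_ ->] _] := Bchi; rewrite mulr0.
- move=> u w k l kF lF kl; rewrite /spec !map_cat /= !big_cat !big_cons /=.
  have iF : pi k l \in F by apply: pi_in.
  rewrite !(pi_id _ iF) !(al_id _ iF).
  have [_ [_ sq] _] := Bchi.
  have [ejk|njk] := eqVneq j k.
    by rewrite -ejk al_diag // !(mul0r, mulr0) add0r sq !mulr0.
  have [ejl|njl] := eqVneq j l.
    rewrite -ejl al_diag // !(mul0r, mulr0) addr0 pi_sym // ?sq ?mulr0 //.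
  have := plane_rel Bchi (map (pi j) u) (map (pi j) w) jF kF lF njk njl kl.
  move=> E; set PU := \prod_(i <- u) _; set PW := \prod_(i <- w) _.
  rewrite (_ : _ * _ * _ = PU * PW * (al j k * al j l *
     chi (map (pi j) u ++ pi j k :: pi j l :: map (pi j) w))); last by ring.
  by rewrite E; ring.
- move=> r Qr u w.
  have [_ _ hQ] := Bchi.
  rewrite (@eq_ev_Q _ _ (fun z => ((\prod_(c <- u) al j c) * (\prod_(c <- w) al j c))
      * chi (map (pi j) u ++ z ++ map (pi j) w))) //; first by rewrite evZ hQ ?mulr0.
  move=> z zF; rewrite /spec !map_cat !big_cat /=.
  rewrite [X in _ * (X * _)]big_seq [X in _ * (X * _)]big1 ?mul1r; last first.
    by move=> c /(allP zF) /al_id.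
  congr (_ * chi (_ ++ _ ++ _)).
  by rewrite -[RHS]map_id; apply/eq_in_map => c /(allP zF) /= /pi_id ->.
Qed.

(* The residue along j as a map on words: the coefficient of x_j when the
   letter j is moved to the front and the rest is specialised along j. *)
Fixpoint res j w : fpoly K n :=
  if w is c :: w' then
    (if c == j then [:: (\prod_(i <- w') al j i, map (pi j) w')] else [::])
    ++ [seq (q * al j c * x.1, pi j c :: x.2) | x <- res j w']
  else [::].

Lemma res_nil j chi : tr (res j) chi [::] = 0.
Proof. by rewrite /tr ev_nil. Qed.

Lemma res_cons j chi c w : tr (res j) chi (c :: w) =
  (c == j)%:R * spec j chi w + q * al j c * tr (res j) (fun z => chi (pi j c :: z)) w.
Proof.
rewrite /tr /= ev_cat ev_prefix; congr (_ + _).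
by case: eqP => _; rewrite !ev_simpl ?mul0r ?mul1r.
Qed.

Lemma homog_res j w c : homog (size w) [seq (x.1, c :: x.2) | x <- res j w].
Proof.
elim: w c => [|d w IH] c //=; rewrite /homog map_cat all_cat; apply/andP; split.
  by case: ifP => //= _; rewrite size_map eqxx.
have := IH (pi j d); rewrite /homog !all_map; apply: sub_all => x /=.
by rewrite eqSS.
Qed.

Lemma res_F j chi w : j \notin F -> all (mem F) w -> tr (res j) chi w = 0.
Proof.
move=> jF; elim: w chi => [|c w IH] chi /=; first by rewrite /tr ev_nil.
case/andP=> cF wF; rewrite res_cons IH // mulr0 addr0.
by case: eqP cF => [->|]; rewrite ?(negPf jF) ?mul0r.
Qed.

Lemma res_catF j chi z w : j \notin F -> all (mem F) z ->
  tr (res j) chi (z ++ w) = q ^+ size z * tr (res j) (fun y => chi (z ++ y)) w.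
Proof.
move=> jF; elim: z chi => [|c z IH] chi /=; first by rewrite mul1r.
case/andP=> cF zF; rewrite res_cons IH //.
rewrite pi_id // al_id // exprS mulr1 mulrA.
by case: eqP cF => [->|]; rewrite ?(negPf jF) ?mul0r ?add0r.
Qed.

(** Letters before a relation are peeled off by [res_cons], whose extra term is a specialisation and
    is settled by [spec_annA]. At the front, the triangle relation of k and l becomes [plane_rel];
    if j is k or l, both sides give the same specialised term and the rest is a square. *)
Lemma res_annA j chi : j \notin F -> annB chi -> annA (tr (res j) chi).
Proof.
move=> jF Bchi.
have Hq u a b w chi' : annB chi' -> tr (res j) chi' (u ++ a :: b :: w) =
    q * tr (res j) chi' (u ++ b :: a :: w).
  elim: u chi' => [|c u IH] chi' Bc; rewrite ?cat_cons ?cat0s.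
    rewrite !res_cons !spec_cons.
    have -> : tr (res j) (fun z => chi' [:: pi j a, pi j b & z]) w =
              q * tr (res j) (fun z => chi' [:: pi j b, pi j a & z]) w.
      rewrite /tr -evZ; apply: eq_ev => z; have [_ [h _] _] := Bc.
      exact: (h [::]).
    move: q2 (tr _ _ w); set X := spec _ _ w; set Y := spec _ _ w => qq T.
    (* After the swap the term with a = j carries [q * q]; its coefficient is the cofactor. *)
    apply: (@eq_mod_square _ (- ((a == j)%:R * al j b * X)) _ _ _ qq); ring.
  rewrite !res_cons IH; last exact: annB_cons.
  have [[-> _] _ _] := spec_annA jF Bc; ring.
have Hs u a w chi' : annB chi' -> tr (res j) chi' (u ++ a :: a :: w) = 0.
  elim: u chi' => [|c u IH] chi' Bc; rewrite ?cat_cons ?cat0s.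
    rewrite !res_cons !spec_cons.
    have -> : tr (res j) (fun z => chi' [:: pi j a, pi j a & z]) w = 0.
      rewrite /tr -[RHS](ev0 (res j w)); apply: eq_ev => z; have [_ [_ h] _] := Bc.
      exact: (h [::]).
    by case: eqP => [->|_]; rewrite ?al_diag //= !(mul0r, mulr0, addr0).
  rewrite !res_cons IH; last exact: annB_cons.
  by have [[_ ->] _ _] := spec_annA jF Bc; ring.
split; first by split=> [u a b w|u a w]; [apply: Hq|apply: Hs].
- move=> u w k l kF lF kl.
  elim: u chi Bchi => [|c u IH] chi' Bc; rewrite ?cat_cons ?cat0s; last first.
    rewrite !res_cons IH; last exact: annB_cons.
    have [_ hT _] := spec_annA jF Bc; rewrite hT //; ring.
  have iF : pi k l \in F by apply: pi_in.
  have inj : (pi k l == j) = false by case: eqP iF => // ->; rewrite (negPf jF).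
  rewrite !res_cons !spec_cons !(pi_id _ iF) !(al_id _ iF) inj.
  have sq : tr (res j) (fun z => chi' [:: pi k l, pi k l & z]) w = 0.
    rewrite /tr -[RHS](ev0 (res j w)); apply: eq_ev => z; have [_ [_ h] _] := Bc.
    exact: (h [::]).
  have [ekj|nkj] := eqVneq k j.
    subst j; rewrite [l == k]eq_sym (negPf kl) al_diag // sq.
    by rewrite !(mulr0, mul0r, addr0, add0r, mul1r, mulr1).
  have [elj|nlj] := eqVneq l j.
    subst j; rewrite al_diag // -(pi_sym kF lF kl) sq.
    by rewrite !(mulr0, mul0r, addr0, add0r, mul1r, mulr1); ring.
  rewrite !(mul0r, add0r, mulr1) /tr.
  set E1 := ev _ _; set E2 := ev _ _; set E3 := ev _ _.
  have -> : q * al j k * (q * al j l * E1) = (q * q) * (al j k * al j l * E1) by ring.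
  have -> : al k l * (q * al j k * (q * E2)) + al l k * (q * (q * al j l * E3)) =
    (q * q) * (al k l * al j k * E2 + al l k * al j l * E3) by ring.
  congr (_ * _); rewrite -!evZ -evD; apply: eq_ev => z.
  by have := plane_rel Bc [::] z jF kF lF; rewrite eq_sym nkj eq_sym nlj kl; apply.
- move=> r Qr u w.
  elim: u chi Bchi => [|c u IH] chi' Bc; last first.
    rewrite (@eq_ev _ _ _ _ (fun z =>
      (c == j)%:R * spec j chi' (u ++ z ++ w)
       + q * al j c * tr (res j) (fun y => chi' (pi j c :: y)) (u ++ z ++ w)));
      last by move=> z; rewrite res_cons.
    rewrite evD !evZ IH; last exact: annB_cons.
    by have [_ _ ->] := spec_annA jF Bc; rewrite // !mulr0 addr0.
  have [d hd] := Q_homog Qr.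
  (* The words of [r] lie in F, so the residue passes over them with the sign [q ^+ size z], which
     is constant because [r] is homogeneous. *)
  rewrite (@eq_ev_Q _ _ (fun z => q ^+ size z * tr (res j) (fun y => chi' (z ++ y)) w)) //;
    last by move=> z zF; rewrite /= res_catF.
  rewrite (@eq_in_ev _ _ d.+2 _ _ (fun z => q ^+ d.+2 * ev (res j w) (fun y => chi' (z ++ y)))) //;
    last by move=> z ->.
  rewrite evZ evC (@eq_ev _ _ _ _ (fun=> 0)) ?ev0 ?mulr0 // => y.
  by have [_ _ h] := Bc; apply: (h r Qr [::]).
Qed.

(** [restr], [total_res] and [left_mul] lift the maps B -> A, A -> X (x) B and the section t_j (x) w
    |-> x_j w of the latter; t_j (x) w is stored as the word j :: w. *)
Definition restr w : fpoly K n := if all (mem F) w then [:: (1, w)] else [::].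

Definition total_res w : fpoly K n :=
  flatten [seq [seq (1 * x.1, j :: x.2) | x <- res j w] | j <- enum (~: F)].

Definition left_mul w : fpoly K n :=
  if w is j :: w' then
    if (j \notin F) && all (mem F) w' then [:: (1, w)] else [::]
  else [::].

Lemma tr_restr psi w : tr restr psi w = (all (mem F) w)%:R * psi w.
Proof. by rewrite /tr /restr; case: ifP; rewrite !ev_simpl ?mul0r. Qed.

Lemma tr_left_mul psi j w :
  tr left_mul psi (j :: w) = ((j \notin F) && all (mem F) w)%:R * psi (j :: w).
Proof. by rewrite /tr /left_mul; case: ifP; rewrite !ev_simpl ?mul0r. Qed.

Lemma tr_total_res chi w :
  tr total_res chi w = \sum_(j in ~: F) tr (res j) (fun z => chi (j :: z)) w.
Proof.
rewrite /tr /total_res /ev big_flatten big_map big_enum /=; apply: eq_bigr => j _.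
by rewrite -/(ev _ _) ev_prefix mul1r.
Qed.

Lemma lenpres_restr : lenpres restr.
Proof. by move=> w; rewrite /restr; case: ifP => //= _; rewrite /homog /= eqxx. Qed.

Lemma lenpres_left_mul : lenpres left_mul.
Proof. by case=> [|j w] //=; case: ifP => //= _; rewrite /homog /= eqxx. Qed.

Lemma lenpres_total_res : lenpres total_res.
Proof.
move=> w; apply/allP => x /flattenP [_ /mapP [j _ ->]] /mapP [y yr ->] /=.
have /allP /(_ (y.1, j :: y.2)) := homog_res j w j.
by apply; apply/mapP; exists y.
Qed.

Lemma annB_restr psi : annA psi -> annB (tr restr psi).
Proof.
case=> [[h1 h2] h3 h4]; split; last 1 first.
- move=> r Qr u w; case uF : (all (mem F) (u ++ w)).
    rewrite (@eq_ev_Q _ _ (fun z => psi (u ++ z ++ w))) ?h4 // => z zF.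
    by move: uF; rewrite tr_restr !all_cat zF => /andP [-> ->]; rewrite mul1r.
  rewrite (@eq_ev _ _ _ _ (fun=> 0)) ?ev0 // => z; move: uF.
  rewrite tr_restr !all_cat => /negbT; rewrite negb_and.
  by case/orP=> /negPf ->; rewrite ?andbF mul0r.
- by move=> w /negPf; rewrite tr_restr => ->; rewrite mul0r.
split=> [u a b w|u a w]; rewrite !tr_restr ?h2 ?mulr0 //.
rewrite h1 mulrCA !all_cat /=; congr (_ * (_%:R * _)); congr (nat_of_bool (_ && _)); exact: andbCA.
Qed.

Lemma restr_annB psi : annB psi -> tr restr psi =1 psi.
Proof.
case=> h _ _ w; rewrite tr_restr.
by case wF: (all (mem F) w); [rewrite mul1r|rewrite mul0r h ?wF].
Qed.

Lemma annB_ext psi chi : psi =1 chi -> annB psi -> annB chi.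
Proof.
move=> E [h3 [h1 h2] h4]; split; last 1 first.
- by move=> r Qr u w; rewrite -[RHS](h4 r Qr u w); apply: eq_ev => z.
- by move=> w; rewrite -!E; apply: h3.
by split=> [u a b w|u a w]; rewrite -!E; [apply: h1|apply: h2].
Qed.

(* A = B + sum_j x_j B. *)
Lemma annA_eq0 psi : annA psi ->
  (forall w, all (mem F) w -> psi w = 0) ->
  (forall j w, j \notin F -> all (mem F) w -> psi (j :: w) = 0) ->
  psi =1 (fun=> 0).
Proof.
move=> Apsi h0 h1 w; elim: w psi Apsi h0 h1 => [|c w IH] psi Apsi h0 h1.
  exact: h0.
apply: (IH (fun z => psi (c :: z))); first exact: annA_cons.
  by move=> z zF; case cF : (c \in F); [apply: h0; rewrite /= cF|apply: h1; rewrite ?cF].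
have [[hq hs] hT _] := Apsi.
(* A word c j z is commuted to j c z. If c is off F as well, the triangle relation trades one of the
   two letters for a point of F, and the remaining one is commuted to the front. *)
move=> j z jF zF; rewrite (hq [::]) /=; case cF : (c \in F).
  by rewrite h1 ?mulr0 //= cF.
have [->|jc] := eqVneq j c; first by rewrite (hs [::]) mulr0.
have iF : pi j c \in F by rewrite pi_in ?cF.
rewrite (hT [::]) ?cF //= h1 //= ?iF // (hq [::]) /= h1 ?cF //= ?iF //.
by rewrite !mulr0 addr0 mulr0.
Qed.

Lemma annA_total_res chi : annX chi -> annA (tr total_res chi).
Proof.
case=> _ _ h; apply: annA_ext (fun w => esym (tr_total_res chi w)) _.
by apply: annA_sum => j; rewrite inE => jF; apply: res_annA.
Qed.

Lemma total_res_F chi w : all (mem F) w -> tr total_res chi w = 0.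
Proof.
by move=> wF; rewrite tr_total_res big1 // => j; rewrite inE => jF; rewrite res_F.
Qed.

Lemma total_res_left chi j w : j \notin F -> all (mem F) w ->
  tr total_res chi (j :: w) = chi (j :: w).
Proof.
move=> jF wF; rewrite tr_total_res (bigD1 j) ?inE //= res_cons eqxx mul1r.
rewrite spec_F // res_F // mulr0 addr0 big1 ?addr0 // => k.
rewrite inE => /andP [kF nkj].
by rewrite res_cons res_F // mulr0 addr0 eq_sym (negPf nkj) mul0r.
Qed.

(** The last clause says that [h] intertwines the substitutions x_k |-> [al j k] x_(pi j k) along j
    and along h j; signs are their own inverses, so they can all stand on one side. *)
Definition equivariant (h : ('I_n -> 'I_n) * ('I_n -> K)) : Prop :=
  [/\ injective h.1, forall i, (h.1 i \in F) = (i \in F), forall i, h.2 i * h.2 i = 1 &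
      forall j k, j \notin F -> k \notin F -> j != k ->
        pi (h.1 j) (h.1 k) = h.1 (pi j k) /\
        al (h.1 j) (h.1 k) = al j k * h.2 k * h.2 (pi j k)].

Lemma equivariant_all h w : equivariant h -> all (mem F) (map h.1 w) = all (mem F) w.
Proof. by case=> _ hF _ _; rewrite all_map; apply: eq_all => i /=; apply: hF. Qed.

Lemma equivariant_pi h j c : equivariant h -> j \notin F -> c != j ->
  pi (h.1 j) (h.1 c) = h.1 (pi j c).
Proof.
case=> hi hF h2 h4 jF cj; case cF : (c \in F); first by rewrite !pi_id ?hF.
by have [] := h4 j c jF (negbT cF); rewrite // eq_sym.
Qed.

Lemma equivariant_al h j c : equivariant h -> j \notin F ->
  h.2 c * al (h.1 j) (h.1 c) = al j c * h.2 (pi j c).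
Proof.
case=> hi hF h2 h4 jF; case cF : (c \in F); first by rewrite !al_id ?pi_id ?hF // mulr1 mul1r.
have [->|cj] := eqVneq c j; first by rewrite !al_diag ?hF // mulr0 mul0r.
have [_ ->] := h4 j c jF (negbT cF) ltac:(by rewrite eq_sym).
by rewrite -[RHS]mul1r -(h2 c); ring.
Qed.

Lemma spec_act h j chi w : equivariant h -> j \notin F ->
  actT h (spec (h.1 j) chi) w = spec j (actT h chi) w.
Proof.
move=> eh jF; rewrite /actT /spec.
elim: w chi => [|c w IH] chi; first by rewrite /= !big_nil.
rewrite /= !big_cons.
have [->|cj] := eqVneq c j.
  have [_ hF _ _] := eh.
  by rewrite !al_diag ?hF // !(mul0r, mulr0).
have := IH (fun z => chi (h.1 (pi j c) :: z)).
rewrite -(equivariant_pi eh) // => E.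
transitivity ((h.2 c * al (h.1 j) (h.1 c)) * ((\prod_(i <- w) h.2 i) *
   ((\prod_(i <- map h.1 w) al (h.1 j) i) *
    chi (pi (h.1 j) (h.1 c) :: map (pi (h.1 j)) (map h.1 w))))); first by ring.
by rewrite E equivariant_al // (equivariant_pi eh) //; ring.
Qed.

(** The factor [h.2 j] is the sign with which h acts on t_j; [total_res_act] absorbs it into the
    word j :: z. *)
Lemma res_act h j chi w : equivariant h -> j \notin F ->
  actT h (tr (res (h.1 j)) chi) w = h.2 j * tr (res j) (actT h chi) w.
Proof.
move=> eh jF; have [hi hF h2 h4] := eh; rewrite /actT.
elim: w chi => [|c w IH] chi; first by rewrite /tr !ev_nil !mulr0.
rewrite map_cons !res_cons big_cons (inj_eq hi).
have [->|cj] := eqVneq c j.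
  have := spec_act chi w eh jF; rewrite {1}/actT => E.
  rewrite !al_diag ?hF // !(mulr0, mul0r, addr0, mul1r) -E; ring.
rewrite !mul0r !add0r.
have := IH (fun z => chi (h.1 (pi j c) :: z)); rewrite -(equivariant_pi eh) // => E.
transitivity (q * (h.2 c * al (h.1 j) (h.1 c)) * ((\prod_(i <- w) h.2 i) *
  tr (res (h.1 j)) (fun z => chi (pi (h.1 j) (h.1 c) :: z)) (map h.1 w))); first by ring.
rewrite E equivariant_al // (equivariant_pi eh) //.
rewrite [in RHS](_ : tr (res j) _ w = h.2 (pi j c) * tr (res j)
   (fun w0 => (\prod_(i <- w0) h.2 i) * chi (h.1 (pi j c) :: map h.1 w0)) w); first by ring.
by rewrite /tr -evZ; apply: eq_ev => z; rewrite /actT big_cons mulrA.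
Qed.

Lemma restr_act h psi : equivariant h -> tr restr (actT h psi) =1 actT h (tr restr psi).
Proof.
move=> eh w; rewrite tr_restr /actT tr_restr equivariant_all //; ring.
Qed.

Lemma total_res_act h psi : equivariant h ->
  tr total_res (actT h psi) =1 actT h (tr total_res psi).
Proof.
move=> eh w; have [hi hF h2 h4] := eh.
rewrite /actT !tr_total_res [in RHS](reindex_inj hi) /= mulr_sumr.
apply: eq_big => [j|j]; first by rewrite !inE hF.
rewrite inE => jF; have := res_act (fun z => psi (h.1 j :: z)) w eh jF.
rewrite {1}/actT => ->; rewrite /tr -evZ; apply: eq_ev => z.
by rewrite /actT big_cons mulrA.
Qed.

Theorem residue_ses acts UA UB UX :
  dualpair UA annA -> dualpair UB annB -> dualpair UX annX ->
  (forall h, acts h -> equivariant h) -> ses acts UB UA UX.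
Proof.
move=> DA DB DX eqv.
apply: (ses_dual DB DA DX lenpres_restr lenpres_total_res lenpres_left_mul).
- exact: annB_restr.
- by move=> chi Bc; exists chi; [apply: annB_annA|apply: restr_annB].
- exact: annA_total_res.
- move=> chi [h0 h1 h2] [|j w]; first by rewrite /tr ev_nil h0.
  rewrite tr_left_mul; case jF : (j \in F); first by rewrite mul0r h1.
  case wF : (all (mem F) w) => /=; last by rewrite mul0r; have [->] := h2 j; rewrite ?wF.
  by rewrite mul1r total_res_left ?jF.
- move=> chi _ w; rewrite tr_restr; case wF : (all (mem F) w); last by rewrite mul0r.
  by rewrite total_res_F ?mulr0.
- move=> psi Apsi psi0.
  (* The preimage of [psi] is given by its values on words j w with j off F and w in F; as [psi]
     vanishes on words in F, [annA_eq0] shows that these values determine it. *)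
  have X : annX (tr left_mul psi).
    split; first by rewrite /tr ev_nil.
      by move=> j w jF; rewrite tr_left_mul jF mul0r.
    move=> j; case jF : (j \in F).
      have Z : annA (fun=> 0) by apply: annA_ext (annA_sub Apsi Apsi) => w; rewrite subrr.
      apply: annB_ext (annB_restr Z) => w.
      by rewrite tr_restr tr_left_mul jF mulr0 mul0r.
    apply: annB_ext (annB_restr (annA_cons j Apsi)) => w.
    by rewrite tr_left_mul tr_restr jF.
  exists (tr left_mul psi) => //.
  move=> w; apply/eqP; rewrite -subr_eq0; apply/eqP.
  apply: (annA_eq0 (annA_sub (annA_total_res X) Apsi)) => [z zF|j z jF zF].
    rewrite total_res_F // sub0r; have := psi0 z.
    by rewrite tr_restr zF mul1r => ->; rewrite oppr0.
  by rewrite total_res_left // tr_left_mul jF zF mul1r subrr.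
- by move=> h psi /eqv eh _; apply: restr_act.
- by move=> h psi /eqv eh _; apply: total_res_act.
Qed.

(** * Straightening in the Koszul dual and the second exact sequence *)

Definition annK psi : Prop := forall u w phi, annA phi ->
  \sum_a \sum_b phi [:: a; b] * psi (u ++ a :: b :: w) = 0.

Definition annKB psi : Prop := offF psi /\ forall u w phi, annB phi ->
  \sum_a \sum_b phi [:: a; b] * psi (u ++ a :: b :: w) = 0.

Definition annKX chi : Prop :=
  [/\ chi [::] = 0, forall j w, j \in F -> chi (j :: w) = 0 &
      forall j, annK (fun w => chi (j :: w))].

Lemma annK_cons c psi : annK psi -> annK (fun w => psi (c :: w)).
Proof. by move=> Kpsi u w phi Aphi; apply: (Kpsi (c :: u)). Qed.

(** One formula covers commutation (c in F), squares (c = j, where both coefficients are 0) and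
    triangles. Its nonzero terms begin, after [u], with a letter of F; [straight] is the transposed
    rule. *)
Lemma annA_straighten phi u w j c : annA phi -> j \notin F ->
  phi (u ++ j :: c :: w) = q * al j c * phi (u ++ pi j c :: j :: w)
     + (c \notin F)%:R * al c j * phi (u ++ pi j c :: c :: w).
Proof.
move=> [[hq hs] hT _] jF; case cF : (c \in F) => /=.
  by rewrite pi_id // al_id // hq !mul0r addr0 mulr1.
have [<-|jc] := eqVneq j c.
  by rewrite hs al_diag // !(mulr0, mul0r) addr0.
by rewrite hT ?cF // mul1r hq mulrA [al j c * q]mulrC.
Qed.

Lemma annB_delta c : c \in F -> annB (fun w => (w == [:: c])%:R).
Proof.
move=> cF; split; last 1 first.
- move=> r /Q_homog [d hd] u w.
  rewrite (@eq_in_ev _ _ _ _ _ (fun=> 0) hd) ?ev0 // => z sz.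
  by case: eqP => // /(congr1 size); rewrite /= !size_cat sz addnCA.
- by move=> w wF; case: eqP wF => // ->; rewrite /= cF.
by split=> [u a b w|u a w]; do 2?[case: eqP => [/(congr1 size)|_];
  first by rewrite size_cat /= !addnS]; rewrite ?mulr0.
Qed.

(** On words starting in F, the residue along j of the functional dual to x_c is q times the
    indicator of the word c j. As a relation of A^! it expresses y_c y_j through words starting off
    F, and induction on the letters before j does the rest. *)
Lemma annK_offF psi : annK psi ->
  (forall j w, j \notin F -> psi (j :: w) = 0) -> offF psi.
Proof.
move=> Kpsi psi0.
have H u j w : j \notin F -> psi (u ++ j :: w) = 0.
  elim/last_ind: u j w => [|u c IH] j w jF; first exact: psi0.
  rewrite cat_rcons; case cF : (c \in F); last by apply: IH; rewrite cF.
  have := Kpsi u w _ (res_annA jF (annB_delta cF)).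
  have E a b : a \in F -> tr (res j) (fun w => (w == [:: c])%:R) [:: a; b]
      = q * (b == j)%:R * (a == c)%:R.
    move=> aF; rewrite !res_cons pi_id // al_id // /spec !big_nil /=.
    rewrite res_nil mulr0 addr0 mul1r mulr1.
    have -> : (a == j) = false by case: eqP aF => // ->; rewrite (negPf jF).
    by rewrite mul0r add0r mulrA eqseq_cons eqxx andbT.
  rewrite (bigD1 c) //= [X in _ + X]big1 ?addr0 => [|a ac].
    rewrite (bigD1 j) //= [X in _ + X]big1 ?addr0 => [|b bj].
      rewrite E // !eqxx !mulr1 => e.
      by rewrite -[LHS]mul1r -q2 -mulrA e mulr0.
    by rewrite E // (negPf bj) mulr0 !mul0r.
  apply: big1 => b _; case aF : (a \in F); last by rewrite IH ?aF ?mulr0.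
  by rewrite E // (negPf ac) mulr0 mul0r.
move=> w /allPn [j /splitPr jw jF]; case: jw => u v.
exact: H.
Qed.

(* Left inverse A^! -> X (x) A^! of multiplication, t_j component: subwords [i j]
   with i in F and j off F are straightened into words starting off F. *)
Fixpoint straight j w : fpoly K n :=
  if w is c :: w' then
    if c \in F then
      flatten [seq [seq (- (q * al j k) * x.1, k :: x.2) | x <- straight j w'] ++
                   [seq (- ((k \notin F)%:R * al k j) * x.1, k :: x.2) | x <- straight k w']
              | k <- enum [pred k | pi j k == c]]
    else if c == j then [:: (1, w')] else [::]
  else [::].

Lemma straight_consF j om c w : c \in F ->
  tr (straight j) om (c :: w) = - \sum_(k | pi j k == c)
     (q * al j k * tr (straight j) (fun z => om (k :: z)) w
      + (k \notin F)%:R * al k j * tr (straight k) (fun z => om (k :: z)) w).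
Proof.
move=> cF; rewrite {1}/tr /= cF {1}/ev big_flatten big_map big_enum /= -sumrN.
apply: eq_bigr => k _; rewrite -/(ev _ _) ev_cat !ev_prefix !mulNr -opprD.
by [].
Qed.

Lemma straight_consX j om c w : c \notin F ->
  tr (straight j) om (c :: w) = (c == j)%:R * om w.
Proof.
move=> cF; rewrite /tr /= (negPf cF).
by case: eqP => _; rewrite !ev_simpl ?mul0r.
Qed.

(** The double sum over b in F and over the c with [pi j c = b] collapses to a single sum over c. *)
Lemma straight_step (g : 'I_n -> K) j om w : j \notin F ->
  \sum_b g b * tr (straight j) om (b :: w) = g j * om w -
  \sum_c g (pi j c) * (q * al j c * tr (straight j) (fun z => om (c :: z)) w
      + (c \notin F)%:R * al c j * tr (straight c) (fun z => om (c :: z)) w).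
Proof.
move=> jF; rewrite (bigID (mem F)) /= addrC; congr (_ + _).
  rewrite (bigD1 j) //= straight_consX // eqxx mul1r big1 ?addr0 // => b /andP [bF nbj].
  by rewrite straight_consX // (negPf nbj) mul0r mulr0.
(* [pi j c] can leave F only for c = j, where both coefficients are [al j j = 0]. *)
rewrite [in RHS](bigID (fun c => pi j c \in F)) /= [X in _ + X]big1 ?addr0; last first.
  move=> c; have [->|cj] := eqVneq c j; first by rewrite al_diag // !(mulr0, mul0r) addr0 mulr0.
  case cF : (c \in F); first by rewrite pi_id ?cF.
  by rewrite pi_in ?cF // eq_sym.
rewrite [in RHS](partition_big (pi j) (mem F)) //= -sumrN; apply: eq_bigr => b bF.
rewrite straight_consF // mulrN mulr_sumr; congr (- _).
by apply: eq_big => [c|c /eqP ->] //; case: eqP => [->|]; rewrite ?bF ?andbF.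
Qed.

(* The pairing of two consecutive straightening steps against [phi] is the
   value of residues of [phi], hence of elements of the annihilator. *)
Lemma res_two_steps phi i k c (X : 'I_n -> K) : annA phi -> i \in F -> k \notin F ->
  \sum_(l in ~: F) tr (res l) (tr restr phi) [:: i; k; c] * X l =
  phi [:: i; pi k c] * (q * al k c * X k + (c \notin F)%:R * al c k * X c).
Proof.
move=> Aphi iF kF.
have Br := annB_restr Aphi.
(* The two letters of F before m cost [q * q = 1]. *)
have E l m i' : l \notin F -> m \notin F -> i' \in F ->
    tr (res l) (tr restr phi) [:: i; i'; m] = (m == l)%:R * phi [:: i; i'].
  move=> lF mF i'F; rewrite (@res_catF _ _ [:: i; i']) //=; last by rewrite iF i'F.
  rewrite res_cons /spec big_nil mul1r res_nil mulr0 addr0.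
  rewrite tr_restr /= iF i'F mul1r expr2 q2 mul1r.
  by [].
have S l : l \in ~: F -> tr (res l) (tr restr phi) [:: i; k; c] * X l =
   phi [:: i; pi k c] * (q * al k c * ((k == l)%:R * X l) +
                        (c \notin F)%:R * al c k * ((c == l)%:R * X l)).
  rewrite inE => lF; rewrite (@annA_straighten _ [:: i]) //=; last exact: res_annA.
  have [->|ck] := eqVneq c k; first by rewrite al_diag // !(mulr0, mul0r) !addr0 mul0r mulr0.
  have pF : pi k c \in F.
    by case cF : (c \in F); [rewrite pi_id|rewrite pi_in ?cF // eq_sym].
  rewrite E //; case cF : (c \in F) => /=; first by ring.
  by rewrite E ?cF //; ring.
rewrite (eq_bigr _ S) -mulr_sumr big_split /= -!mulr_sumr; congr (_ * (_ * _ + _)).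
  rewrite (bigD1 k) ?inE //= eqxx mul1r big1 ?addr0 // => l /andP [_ lk].
  by rewrite eq_sym (negPf lk) mul0r.
case cF : (c \in F) => /=; first by rewrite !mul0r.
rewrite (bigD1 c) ?inE ?cF //= eqxx !mul1r big1 ?addr0 // => l /andP [_ lk].
by rewrite eq_sym (negPf lk) mul0r.
Qed.

(** The recursion absorbs the prefix [u]. At the front, [straight_step] is applied twice: the
    once-straightened terms cancel, and the twice-straightened ones assemble into residues of [phi]
    paired with [om]. *)
Lemma straight_annK j om : j \notin F -> annK om -> annK (tr (straight j) om).
Proof.
move=> jF Kom u; elim: u j om jF Kom => [|c u IH] j om jF Kom w phi Aphi; last first.
  case cF : (c \in F).
    under eq_bigr => a _ do under eq_bigr => b _ do
      rewrite cat_cons straight_consF // mulrN mulr_sumr.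
    under eq_bigr => a _ do rewrite sumrN exchange_big.
    rewrite sumrN exchange_big /= big1 ?oppr0 // => k _.
    under eq_bigr => a _ do under eq_bigr => b _ do rewrite mulrDr ![phi _ * (_ * _)]mulrCA.
    under eq_bigr => a _ do rewrite big_split /= -!mulr_sumr.
    rewrite big_split /= -!mulr_sumr.
    rewrite (IH j) //; last exact: annK_cons.
    case kF : (k \in F) => /=; first by rewrite !mul0r mulr0 addr0.
    by rewrite (IH k) ?kF ?mulr0 ?addr0 //; apply: annK_cons.
  under eq_bigr => a _ do under eq_bigr => b _ do
    rewrite cat_cons straight_consX ?cF // mulrCA.
  under eq_bigr => a _ do rewrite -mulr_sumr.
  by rewrite -mulr_sumr (Kom u) // mulr0.
rewrite exchange_big /=.
under eq_bigr => b _ do rewrite (straight_step (fun a => phi [:: a; b])) //.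
rewrite sumrB exchange_big /=.
(* For fixed c, the second straightening step, combined with [annA_straighten] for [phi] and for its
   residues, returns the term of the first step minus a sum of residues. *)
have step c : \sum_(b < n) phi [:: pi j c; b] *
      (q * al j c * tr (straight j) (fun z => om (c :: z)) (b :: w)
       + (c \notin F)%:R * al c j * tr (straight c) (fun z => om (c :: z)) (b :: w))
    = phi [:: j; c] * om (c :: w) -
      \sum_(c' < n) \sum_(l in ~: F) tr (res l) (tr restr phi) [:: j; c; c'] *
         tr (straight l) (fun z => om [:: c, c' & z]) w.
  have [->|cj] := eqVneq c j.
    rewrite al_diag // big1 => [|b _]; last by rewrite !(mulr0, mul0r) addr0 mulr0.
    have [[_ hs] _ _] := Aphi; rewrite (hs [::]) mul0r sub0r big1 ?oppr0 // => c' _.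
    rewrite big1 // => l; rewrite inE => lF.
    have [[_ hs'] _ _] := res_annA lF (annB_restr Aphi).
    by rewrite (hs' [::]) mul0r.
  have pF : pi j c \in F.
    by case cF : (c \in F); [rewrite pi_id|rewrite pi_in ?cF // eq_sym].
  have two k : k \notin F -> \sum_(b < n) phi [:: pi j c; b] *
      tr (straight k) (fun z => om (c :: z)) (b :: w) =
      phi [:: pi j c; k] * om (c :: w) -
      \sum_(c' < n) \sum_(l in ~: F) tr (res l) (tr restr phi) [:: pi j c; k; c'] *
         tr (straight l) (fun z => om [:: c, c' & z]) w.
    move=> kF; rewrite straight_step //; congr (_ - _); apply: eq_bigr => c' _.
    by rewrite (res_two_steps c' (fun l => tr (straight l) (fun z => om [:: c, c' & z]) w)).
  under eq_bigr => b _ do rewrite mulrDr ![phi _ * (_ * _)]mulrCA.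
  rewrite big_split /= -!mulr_sumr two // (@annA_straighten _ [::] [::] j c Aphi jF) /=.
  under [in RHS]eq_bigr => c' _.
    under eq_bigr => l lF.
      rewrite (annA_straighten [::] [:: c']) //=; last first.
        by apply: res_annA; [rewrite inE in lF|apply: annB_restr].
      rewrite mulrDl -![_ * _ * tr (straight _) _ _]mulrA.
      over.
    rewrite big_split /= -!mulr_sumr; over.
  rewrite big_split /= -!mulr_sumr.
  case cF : (c \in F) => /=; first by rewrite !mul0r !addr0; ring.
  by rewrite two ?cF //; ring.
rewrite [X in _ - X](eq_bigr _ (fun c _ => step c)).
rewrite sumrB subKr.
under eq_bigr => c _ do rewrite exchange_big.
rewrite exchange_big /= big1 // => l; rewrite inE => lF.
(* Contracting the first letter j turns the degree-3 residue into a degree-2 functional on A, that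
   is, into a relation that [om] satisfies. *)
have Ares := annA_cons j (res_annA lF (annB_restr Aphi)).
rewrite -[RHS](ev0 (straight l w)).
under eq_bigr => c _ do (under eq_bigr => c' _ do rewrite /tr -evZ); rewrite -?ev_sum.
under eq_bigr => c _ do rewrite -ev_sum.
by rewrite -ev_sum; apply: eq_ev => z; apply: (Kom [::] z _ Ares).
Qed.

(** This lifts left multiplication X (x) A^! -> A^!; words starting in F represent 0 in X (x)
    A^!. *)
Definition off_start w : fpoly K n :=
  if w is j :: _ then if j \notin F then [:: (1, w)] else [::] else [::].

Lemma tr_off_start psi j w :
  tr off_start psi (j :: w) = (j \notin F)%:R * psi (j :: w).
Proof. by rewrite /tr /off_start; case: (j \notin F); rewrite !ev_simpl ?mul0r. Qed.

Lemma annK_scale a psi : annK psi -> annK (fun w => a * psi w).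
Proof.
move=> Kpsi u w phi Aphi; rewrite -[RHS](mulr0 a) -[X in _ = _ * X](Kpsi u w phi Aphi) mulr_sumr.
apply: eq_bigr => x _; rewrite mulr_sumr; apply: eq_bigr => y _.
by rewrite mulrCA.
Qed.

Lemma annK_sum (J : finType) (P : pred J) (psi : J -> seq 'I_n -> K) :
  (forall x, P x -> annK (psi x)) -> annK (fun w => \sum_(x | P x) psi x w).
Proof.
move=> H u w phi Aphi.
under eq_bigr => a _ do under eq_bigr => b _ do rewrite mulr_sumr.
under eq_bigr => a _ do rewrite exchange_big.
rewrite exchange_big /= big1 // => x Px; exact: H.
Qed.

Lemma annK_ext psi chi : psi =1 chi -> annK psi -> annK chi.
Proof.
move=> E Kpsi u w phi Aphi; rewrite -[RHS](Kpsi u w phi Aphi).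
by apply: eq_bigr => a _; apply: eq_bigr => b _; rewrite E.
Qed.

(** [psi] sees only words in F, so a functional on A pairs with it through its restriction to F. *)
Lemma annKB_annK psi : annKB psi -> annK psi.
Proof.
case=> h0 h u w phi Aphi; rewrite -[RHS](h u w _ (annB_restr Aphi)).
apply: eq_bigr => a _; apply: eq_bigr => b _; rewrite tr_restr.
case abF : (all _ _); first by rewrite mul1r.
rewrite h0 ?mulr0 // all_cat; apply/negP => /andP [_] /= /and3P [aF bF _].
by rewrite /= aF bF in abF.
Qed.

Theorem koszul_ses acts UX UK UKB :
  dualpair UX annKX -> dualpair UK annK -> dualpair UKB annKB ->
  (forall h, acts h -> equivariant h) -> ses acts UX UK UKB.
Proof.
move=> DX DK DB eqv.
pose L1 (w : seq 'I_n) : fpoly K n := [:: (1, w)].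
have trL1 psi : tr L1 psi =1 psi by move=> w; rewrite /tr /L1 !ev_simpl mul1r.
have lpL1 : lenpres L1 by move=> w; rewrite /L1 /homog /= eqxx.
have lpo : lenpres off_start.
  by case=> [|j w] //; rewrite /off_start; case: ifP => // _; rewrite /homog /= eqxx.
apply: (ses_dual DX DK DB lpo lpL1 lpL1).
- move=> psi Kpsi; split; first by rewrite /tr ev_nil.
    by move=> j w jF; rewrite tr_off_start jF mul0r.
  move=> j; apply: annK_ext (annK_scale (j \notin F)%:R (annK_cons j Kpsi)) => w.
  by rewrite tr_off_start.
- move=> chi [h0 h1 h2].
  exists (fun w => \sum_(j in ~: F) tr (straight j) (fun z => chi (j :: z)) w).
    by apply: annK_sum => j; rewrite inE => jF; apply: straight_annK.
  case=> [|c w]; first by rewrite /tr ev_nil h0.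
  rewrite tr_off_start; case cF : (c \in F); first by rewrite mul0r h1.
  rewrite mul1r (bigD1 c) ?inE ?cF //= straight_consX ?cF // eqxx mul1r.
  rewrite big1 ?addr0 // => j /andP [_ jc].
  by rewrite straight_consX ?cF // eq_sym (negPf jc) mul0r.
- by move=> psi KBpsi; apply: annK_ext (annKB_annK KBpsi) => w; rewrite trL1.
- by move=> psi _ w; rewrite !trL1.
- move=> psi [h0 _] [|j w]; first by rewrite /tr ev_nil.
  rewrite tr_off_start trL1; case jF : (j \in F); first by rewrite mul0r.
  by rewrite h0 ?mulr0 //= jF.
- move=> psi Kpsi psi0; exists psi => //; split; last first.
    by move=> u w phi Bphi; apply: Kpsi; apply: annB_annA.
  apply: annK_offF => // j w jF.
  by have := psi0 (j :: w); rewrite tr_off_start jF mul1r.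
- move=> h psi /eqv eh _ [|j w]; first by rewrite /actT /tr !ev_nil mulr0.
  have [_ hF _ _] := eh.
  by rewrite /actT /= !tr_off_start hF; ring.
- by move=> h psi _ _ w; rewrite /actT !trL1.
Qed.

End Residue.

(** * Rank and flats from circuits; lines meet a modular hyperplane *)

Section MatroidRank.
Set Implicit Arguments. Unset Strict Implicit. Unset Printing Implicit Defensive.
Variables (n : nat) (C : {set {set 'I_n}}).
Implicit Types (S T X Y I J B F : {set 'I_n}).
Hypothesis hC : matroid_circuits C.

Lemma indepPn S : reflect (exists2 X, X \in C & X \subset S) (~~ indep C S).
Proof.
rewrite /indep negb_forall_in; apply: (iffP existsP) => [[X /andP [XC]]|[X XC XS]].
  by rewrite negbK => XS; exists X.
by exists X; rewrite XC negbK.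
Qed.

Lemma indepS S T : S \subset T -> indep C T -> indep C S.
Proof.
move=> ST; apply: contraTT => /indepPn [X XC XS]; apply/indepPn.
by exists X => //; apply: subset_trans ST.
Qed.

Lemma indep_circuit S X : indep C S -> X \in C -> ~~ (X \subset S).
Proof. by move=> IS XC; apply/negP => XS; move: IS; apply/negP/indepPn; exists X. Qed.

Lemma circuit_rem X e : X \in C -> e \in X -> indep C (X :\ e).
Proof.
move=> XC eX; apply/negPn/negP => /indepPn [Y YC YX].
have [_ hi _] := hC; have E := hi Y X YC XC (subset_trans YX (subD1set _ _)).
by have := subsetP YX e; rewrite E eX !inE eqxx => /(_ isT).
Qed.

(** If no augmentation exists, take T independent in the union of I and J, larger than I, with
    fewest elements of I missing. A missing e lies in a circuit of e + T avoiding any prescribed f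
    in T outside I; eliminating e from two such circuits leaves a circuit inside T. *)
Lemma indep_augment I J : indep C I -> indep C J -> (#|I| < #|J|)%N ->
  exists2 e, e \in J :\: I & indep C (e |: I).
Proof.
move=> II IJ lt; apply/exists_inP; apply: contraT => /exists_inPn H.
pose P (T : {set 'I_n}) := [&& T \subset I :|: J, indep C T & (#|I| < #|T|)%N].
have PJ : P J by rewrite /P subsetUr IJ.
case: (arg_minnP (fun T : {set 'I_n} => #|I :\: T|) PJ) => T /and3P [TIJ IT ltT] minT.
have [e eI eT] : exists2 e, e \in I & e \notin T.
  apply/subsetPn/negP => IsubT.
  have [f fT fI] : exists2 f, f \in T & f \notin I.
    by apply/subsetPn/negP => /subset_leq_card; rewrite leqNgt ltT.
  have fJ : f \in J :\: I by have := subsetP TIJ f fT; rewrite !inE (negPf fI).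
  case/negP: (H f fJ); apply: indepS IT; apply/subsetP => x.
  by rewrite !inE => /orP [/eqP ->|/(subsetP IsubT)].
(* By minimality of T, exchanging f for e destroys independence. *)
have circ f : f \in T :\: I ->
    exists Y, [/\ Y \in C, e \in Y, f \notin Y & Y \subset e |: T].
  rewrite inE => /andP [fI fT].
  have: ~~ indep C (e |: (T :\ f)).
    apply/negP => Ind.
    have: P (e |: (T :\ f)).
      rewrite /P Ind cardsU1 !inE (negPf eT) andbF /= add1n.
      rewrite [#|T|](cardsD1 f) fT add1n in ltT; rewrite ltT andbT.
      apply/subsetP => x; rewrite !inE => /orP [/eqP ->|/andP [_ xT]]; first by rewrite eI.
      by have := subsetP TIJ x xT; rewrite inE.
    move=> /minT; rewrite leqNgt => /negP; apply.
    apply: proper_card; apply/properP; split.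
      apply/subsetP => x; rewrite !inE; case: (eqVneq x f) => [->|_].
        by rewrite (negPf fI) andbF.
      by case: (x \in T); rewrite /= ?orbT // => /andP [].
    by exists e; rewrite !inE ?eqxx ?eI ?eT.
  case/indepPn => Y YC YS; exists Y; split=> //.
  - apply/negPn/negP => eY; case/negP: (indep_circuit IT YC).
    apply/subsetP => x xY; have := subsetP YS x xY; rewrite !inE.
    by case: (eqVneq x e) xY eY => [->->//|_ _ _ /= /andP []].
  - apply/negP => /(subsetP YS); rewrite !inE eqxx /= orbF => /eqP fe.
    by rewrite -fe fT in eT.
  - apply: subset_trans YS _; apply: setUS; exact: subD1set.
have [g gTI] : exists g, g \in T :\: I.
  have [g gT gI] : exists2 g, g \in T & g \notin I.
    by apply/subsetPn/negP => /subset_leq_card; rewrite leqNgt ltT.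
  by exists g; rewrite inE gI.
have [Y [YC eY gY YS]] := circ g gTI.
have [h hY hTI] : exists2 h, h \in Y & h \in T :\: I.
  have [h hY hI] : exists2 h, h \in Y & h \notin I.
    by apply/subsetPn; apply: indep_circuit.
  exists h => //; have := subsetP YS h hY; rewrite !inE hI.
  by case/orP=> // /eqP he; rewrite he eI in hI.
have [Z [ZC eZ hZ ZS]] := circ h hTI.
have YZ : Y != Z by apply: contraNneq hZ => <-.
have [_ _ helim] := hC.
have [W WC WS] : exists2 W, W \in C & W \subset (Y :|: Z) :\ e.
  by apply: (helim Y Z e) => //; rewrite inE eY.
case/negP: (indep_circuit IT WC); apply: subset_trans WS _.
apply/subsetP => x; rewrite !inE => /andP [xe /orP [/(subsetP YS)|/(subsetP ZS)]];
by rewrite !inE (negPf xe).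
Qed.

Lemma rk_ge I S : I \subset S -> indep C I -> (#|I| <= rk C S)%N.
Proof. by move=> IS II; rewrite /rk (bigD1 I) ?IS //= leq_maxl. Qed.

Lemma rk_le S m : (forall I, I \subset S -> indep C I -> (#|I| <= m)%N) -> (rk C S <= m)%N.
Proof. by move=> H; apply/bigmax_leqP => I /andP []; apply: H. Qed.

Lemma rkS S T : S \subset T -> (rk C S <= rk C T)%N.
Proof. by move=> ST; apply: rk_le => I IS; apply: rk_ge; apply: subset_trans ST. Qed.

Lemma rk_card S : (rk C S <= #|S|)%N.
Proof. by apply: rk_le => I /subset_leq_card. Qed.

Lemma basis_extend I S : I \subset S -> indep C I ->
  exists B, [/\ I \subset B, B \subset S, indep C B & #|B| = rk C S].
Proof.
move=> IS II.
pose P B := [&& I \subset B, B \subset S & indep C B].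
have PI : P I by rewrite /P subxx IS.
case: (arg_maxnP (fun B : {set 'I_n} => #|B|) PI) => B /and3P [IB BS IndB] maxB.
exists B; split=> //; apply/eqP; rewrite eqn_leq rk_ge //=; apply: rk_le => J JS IJ.
rewrite leqNgt; apply/negP => /(indep_augment IndB IJ) [e].
rewrite inE => /andP [eB eJ] IeB.
have: P (e |: B).
  rewrite /P IeB andbT (subset_trans IB (subsetUr _ _)) subUset sub1set.
  by rewrite (subsetP JS) // BS.
by move=> /maxB; rewrite /= cardsU1 eB add1n ltnn.
Qed.

Lemma basis_exists S : indep C set0 ->
  exists B, [/\ B \subset S, indep C B & #|B| = rk C S].
Proof.
by move=> I0; have [B [_ ? ? ?]] := basis_extend (sub0set S) I0; exists B.
Qed.

Lemma indep0 : indep C set0.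
Proof.
have [h0 _ _] := hC; apply/negPn/negP => /indepPn [X XC].
by rewrite subset0 => /eqP X0; rewrite X0 (negPf h0) in XC.
Qed.

Lemma closure_sub S : S \subset Defs.closure C S.
Proof. by apply/subsetP => e eS; rewrite inE (setUidPr _) ?sub1set. Qed.

(** If a basis of S could be augmented inside the closure, the new element would raise the rank of
    S. *)
Lemma rk_closure S : rk C (Defs.closure C S) = rk C S.
Proof.
apply/eqP; rewrite eqn_leq (rkS (closure_sub S)) andbT.
have [B [BS IB eB]] := basis_exists S indep0.
rewrite leqNgt; apply/negP => lt.
have [B' [B'S IB' eB']] := basis_exists (Defs.closure C S) indep0.
have [e] := indep_augment IB IB' ltac:(by rewrite eB eB').
rewrite inE => /andP [eNB /(subsetP B'S)]; rewrite inE => /eqP ecl IeB.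
have := rk_ge (setUS [set e] BS) IeB.
by rewrite ecl cardsU1 eNB add1n eB ltnn.
Qed.

Lemma closure_flat S : flat C (Defs.closure C S).
Proof.
apply/eqP/eqP; rewrite eqEsubset closure_sub andbT; apply/subsetP => e.
rewrite !inE => /eqP E; rewrite eqn_leq (rkS (subsetUr _ _)) andbT.
by rewrite -(rk_closure S) -E rkS // setUS ?closure_sub.
Qed.

Lemma flat_circuit F X e : flat C F -> X \in C -> e \in X -> X :\ e \subset F -> e \in F.
Proof.
move=> /eqP fF XC eX XF; rewrite -fF inE eqn_leq (rkS (subsetUr _ _)) andbT.
have [B [XB BF IB eB]] := basis_extend XF (circuit_rem XC eX).
rewrite -eB leqNgt; apply/negP => lt.
have [B' [B'S IB' eB']] := basis_exists (e |: F) indep0.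
have [f] := indep_augment IB IB' ltac:(by rewrite eB').
rewrite inE => /andP [fNB /(subsetP B'S)]; rewrite !inE => /orP [/eqP fe|fF'] IfB.
  case/negP: (indep_circuit IfB XC); rewrite fe; apply/subsetP => x xX.
  by rewrite !inE; case: eqVneq => //= xe; rewrite (subsetP XB) // !inE xe.
have fBF : f |: B \subset F by rewrite subUset sub1set fF'.
by have := rk_ge fBF IfB; rewrite cardsU1 fNB add1n eB ltnn.
Qed.

(** For the line L through j and k, modularity gives r(F v L) + r(F ^ L) = r(F) + 2, while r(F v L)
    is at most r(F) + 1. So F and L share a point i, and simplicity makes the dependent set {i, j,
    k} a circuit. *)
Lemma modular_hyperplane_line F j k : simple_matroid C -> modular_flat C F ->
  (rk C F).+1 = rk C setT -> j \notin F -> k \notin F -> j != k ->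
  exists2 i, i \in F & [set i; j; k] \in C.
Proof.
move=> sC /andP [fF /forall_inP mF] rF jF kF jk.
have Ijk : indep C [set j; k].
  apply/negPn/negP => /indepPn [X /sC lt /subset_leq_card]; rewrite cards2 jk.
  by rewrite leqNgt lt.
pose L := Defs.closure C [set j; k].
have rL : rk C L = 2.
  rewrite rk_closure; apply/eqP; rewrite eqn_leq; apply/andP; split.
    by apply: leq_trans (rk_card _) _; rewrite cards2 jk.
  by have := rk_ge (subxx _) Ijk; rewrite cards2 jk.
have := mF L (closure_flat _) => /eqP E.
have: (0 < rk C (F :&: L))%N.
  have := rkS (subsetT (Defs.closure C (F :|: L))).
  rewrite -rF; move: E; rewrite rL.
  case: (rk C (F :&: L)) => // E; rewrite addn0 in E.
  by rewrite E addn2 ltnn.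
move=> lt; have [i iFL] : exists i, i \in F :&: L.
  apply/set0Pn; apply: contraTneq lt => ->; rewrite -leqNgt.
  by apply: leq_trans (rk_card _) _; rewrite cards0.
move: iFL; rewrite inE => /andP [iF]; rewrite inE => /eqP Ei.
have nij : i != j by apply: contraNneq jF => <-.
have nik : i != k by apply: contraNneq kF => <-.
exists i => //.
have c3 : #|[set i; j; k]| = 3.
  by rewrite -setUA cardsU1 !inE negb_or nij nik cards2 jk.
have [X XC XS] : exists2 X, X \in C & X \subset [set i; j; k].
  apply/indepPn/negP => II; have := rk_ge (subxx _) II.
  rewrite c3 -setUA Ei leqNgt => /negP; apply; rewrite ltnS.
  by apply: leq_trans (rk_card _) _; rewrite cards2 jk.
suff -> : [set i; j; k] = X by [].
by apply/eqP; rewrite eq_sym eqEcard XS c3; apply: sC.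
Qed.

End MatroidRank.

(** * The boundary of a monomial as a q-derivation *)

Section Derivation.
Set Implicit Arguments. Unset Strict Implicit. Unset Printing Implicit Defensive.
Variables (K : fieldType) (n : nat) (q : K).
Implicit Types (s t : seq 'I_n) (f g : 'I_n -> K) (psi : seq 'I_n -> K).
Hypothesis q2 : q * q = 1.

(* The q-derivation sending x_c to [f c], applied to the monomial s. *)
Fixpoint qder f s : fpoly K n :=
  if s is c :: s' then (f c, s') :: [seq (q * x.1, c :: x.2) | x <- qder f s'] else [::].

Lemma ev_qder_cons f c s psi :
  ev (qder f (c :: s)) psi = f c * psi s + q * ev (qder f s) (fun z => psi (c :: z)).
Proof. by rewrite ev_cons ev_prefix. Qed.

Lemma ev_qder_nil f psi : ev (qder f [::]) psi = 0.
Proof. exact: ev_nil. Qed.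

Lemma ev_qder_scale a f g s psi : {in s, forall c, f c = a * g c} ->
  ev (qder f s) psi = a * ev (qder g s) psi.
Proof.
elim: s psi => [|c s IH] psi H; first by rewrite !ev_qder_nil mulr0.
rewrite !ev_qder_cons H ?mem_head // IH; last first.
  by move=> x xs; apply: H; rewrite inE xs orbT.
by ring.
Qed.

Lemma qder_size f s : all (fun x => size x.2 == (size s).-1) (qder f s).
Proof.
elim: s => [|c s IH] //; rewrite [qder _ _]/= [all _ _]/= eqxx all_map.
by case: s IH => [|d s] // IH; apply: sub_all IH => x /= /eqP ->.
Qed.

Lemma qder_all (P : pred 'I_n) f s : all P s -> all (fun x => all P x.2) (qder f s).
Proof.
elim: s => [|c s IH] //= /andP [Pc Ps]; rewrite Ps all_map.
by apply: sub_all (IH Ps) => x /= ->; rewrite Pc.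
Qed.

Lemma qcomm_cons psi c : qcomm q psi -> qcomm q (fun z => psi (c :: z)).
Proof.
by case=> h1 h2; split=> [u a b w|u a w]; [apply: (h1 (c :: u))|apply: (h2 (c :: u))].
Qed.

(** Moving a letter changes a monomial and its derivative by the same sign. Both must be tracked,
    since the derivative of c s contains the monomial s. *)
Lemma qder_front f c s t : exists2 a : K, a * a = 1 &
  forall psi, qcomm q psi -> psi (s ++ c :: t) = a * psi (c :: s ++ t) /\
   ev (qder f (s ++ c :: t)) psi = a * ev (qder f (c :: s ++ t)) psi.
Proof.
elim: s => [|d s [a a2 IH]]; first by exists 1; rewrite ?mulr1 // => psi _; rewrite !mul1r.
exists (q * a) => [|psi Qpsi]; first by ring: q2 a2.
have Qd := qcomm_cons d Qpsi; have Qc := qcomm_cons c Qpsi.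
have [e1 e2] := IH _ Qd; have [e3 _] := IH _ Qpsi.
have sw z : psi [:: d, c & z] = q * psi [:: c, d & z] by case: Qpsi => h _; apply: (h [::]).
split; first by rewrite cat_cons e1 sw; ring.
rewrite !cat_cons ev_qder_cons e3 e2 !ev_qder_cons.
rewrite (@eq_ev _ _ _ _ (fun z => q * psi [:: c, d & z])); last by move=> z; rewrite sw.
by rewrite evZ; ring: q2.
Qed.

(** Hence a circuit relation may be tested in any ordering of the circuit. *)
Lemma qder_perm f s t : perm_eq s t -> exists2 a : K, a * a = 1 &
  forall psi, qcomm q psi -> psi s = a * psi t /\
    ev (qder f s) psi = a * ev (qder f t) psi.
Proof.
elim: t s => [|c t IH] s.
  by move=> /perm_nilP ->; exists 1; rewrite ?mulr1 // => psi _; rewrite !mul1r.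
move=> st; have cs : c \in s by rewrite (perm_mem st) mem_head.
case/splitPr: cs st => s1 s2 st.
have st' : perm_eq (s1 ++ s2) t.
  by rewrite -(perm_cons c) -(permPr st) -[c :: s1 ++ s2]cat1s -[c :: s2]cat1s perm_catCA.
have [a a2 Ha] := qder_front f c s1 s2; have [b b2 Hb] := IH _ st'.
exists (a * b) => [|psi Qpsi]; first by ring: a2 b2.
have [-> ->] := Ha _ Qpsi; have Qc := qcomm_cons c Qpsi.
have [e1 e2] := Hb _ Qc; have [e3 _] := Hb _ Qpsi.
by rewrite !ev_qder_cons e2 e3 [psi _]e1; split; ring.
Qed.

End Derivation.

(** * Signed circuits: all relations of A from triangles and circuits in F *)

Section SignedCircuits.
Set Implicit Arguments. Unset Strict Implicit. Unset Printing Implicit Defensive.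
Variables (K : fieldType) (n : nat) (C : {set {set 'I_n}}) (F : {set 'I_n}).
Variables (q : K) (sg : {set 'I_n} -> 'I_n -> K).
Implicit Types (X Y Z : {set 'I_n}) (i j k l : 'I_n) (psi chi phi : seq 'I_n -> K).
Hypothesis q2 : q * q = 1.
Hypothesis hC : matroid_circuits C.
Hypothesis sC : simple_matroid C.
Hypothesis fF : flat C F.
Hypothesis lineF : forall j k, j \notin F -> k \notin F -> j != k ->
  exists2 i, i \in F & [set i; j; k] \in C.
Hypothesis sg2 : forall X c, X \in C -> c \in X -> sg X c * sg X c = 1.
(* Elimination of e from the signed circuits X and Y; for q = -1 and sg = 1 this
   is circuit elimination, for q = 1 oriented circuit elimination. *)
Hypothesis sg_elim : forall X Y e, X \in C -> Y \in C -> X != Y -> e \in X -> e \in Y ->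
  exists2 Z, Z \in C /\ Z \subset (X :|: Y) :\ e & exists a : K,
    [/\ a * a = 1, {in Z, forall z, z \notin Y -> a * sg Z z = sg X z} &
        {in Z, forall z, z \notin X -> a * sg Z z = - q * sg X e * sg Y e * sg Y z}].

(** The default [j] is returned only when no circuit {i, j, k} with i in F exists, which [meet_ptP]
    excludes for distinct j and k off F. *)
Definition meet_pt j k : 'I_n :=
  if k \in F then k else odflt j [pick i in F | [set i; j; k] \in C].

Definition tri j k : {set 'I_n} := [set meet_pt j k; j; k].

(** The last value comes from solving the relation of the circuit {i, j, k} for x_j x_k. Being a
    product of two signs of one circuit, it is unchanged when all signs of the circuit are
    reversed. *)
Definition spec_coef j k : K :=
  if k \in F then 1 else if j == k then 0
  else - q * sg (tri j k) (meet_pt j k) * sg (tri j k) k.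

Definition circuit_rel X : fpoly K n := qder q (sg X) (sorted_enum X).

Definition flat_rels (r : fpoly K n) : Prop :=
  exists X, [/\ X \in C, X \subset F & r = circuit_rel X].

Let annA' := annA F q meet_pt spec_coef flat_rels.
Let annB' := annB F q flat_rels.

Lemma circuit_card X : X \in C -> (2 < #|X|)%N. Proof. exact: sC. Qed.

Lemma circuit_incl X Y : X \in C -> Y \in C -> X \subset Y -> X = Y.
Proof. by have [_ + _] := hC; apply. Qed.

Lemma meet_ptP j k : j \notin F -> k \notin F -> j != k ->
  meet_pt j k \in F /\ tri j k \in C.
Proof.
move=> jF kF jk; rewrite /tri /meet_pt (negPf kF); case: pickP => [i /andP [iF iC]//|H].
by have [i iF iC] := lineF jF kF jk; have := H i; rewrite iF iC.
Qed.

Lemma circuit_card3 X i j k : X \in C -> X \subset [set i; j; k] -> X = [set i; j; k].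
Proof.
move=> XC XS; apply/eqP; rewrite eqEcard XS.
apply: leq_trans (circuit_card XC).
rewrite -setUA; apply: leq_trans (leq_card_setU _ _) _; rewrite cards1.
by rewrite cards2 !add1n; case: (_ != _).
Qed.

Lemma circuit_not2 X i j : X \in C -> X \subset [set i; j] -> False.
Proof.
move=> XC /subset_leq_card; have := circuit_card XC; rewrite cards2.
by move=> h1 h2; have := leq_trans h1 h2; case: (_ != _).
Qed.

Lemma circuit_off1 X e : X \in C -> e \notin F -> X :\ e \subset F -> e \notin X.
Proof.
by move=> XC eF XF; apply/negP => eX; case/negP: eF; apply: (flat_circuit hC fF XC eX XF).
Qed.

Lemma circuit_two_off X : X \in C -> ~~ (X \subset F) ->
  exists j k, [/\ j \in X, k \in X, j \notin F, k \notin F & j != k].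
Proof.
move=> XC /subsetPn [j jX jF].
have: ~~ (X :\ j \subset F).
  by apply/negP => /(circuit_off1 XC jF); rewrite jX.
case/subsetPn => k; rewrite !inE => /andP [kj kX] kF.
by exists j, k; rewrite eq_sym.
Qed.

(** Two such points i and i' give, by elimination of j, a circuit in {i, i', k}. It cannot leave the
    flat F in k alone, and {i, i'} is too small. *)
Lemma meet_pt_uniq i j k : i \in F -> j \notin F -> k \notin F -> j != k ->
  [set i; j; k] \in C -> meet_pt j k = i.
Proof.
move=> iF jF kF jk iC; have [pF pC] := meet_ptP jF kF jk.
apply/eqP; apply/negPn/negP => ne.
have neS : [set i; j; k] != tri j k.
  apply/negP => /eqP E; have : i \in tri j k by rewrite -E !inE eqxx.
  rewrite !inE eq_sym (negPf ne) /=; case/orP => /eqP e.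
    by rewrite e (negPf jF) in iF.
  by rewrite e (negPf kF) in iF.
have [||Z [ZC ZS] _] := sg_elim (e := j) iC pC neS; rewrite ?inE ?eqxx ?orbT //.
have kZ : k \notin Z.
  apply: circuit_off1 => //; apply/subsetP => x; rewrite !inE => /andP [xk xZ].
  have := subsetP ZS x xZ; rewrite !inE (negPf xk) !orbF.
  by case: (x == j); rewrite ?orbF //= => /orP [/eqP ->|/eqP ->].
apply: (@circuit_not2 Z i (meet_pt j k)) => //; apply/subsetP => x xZ.
have := subsetP ZS x xZ; rewrite !inE.
have -> : x == k = false by apply: contraNF kZ => /eqP <-.
by case: (x == j); rewrite ?orbF.
Qed.

Lemma meet_pt_sym j k : j \notin F -> k \notin F -> j != k -> meet_pt j k = meet_pt k j.
Proof.
move=> jF kF jk; have kj : k != j by rewrite eq_sym.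
have [pF pC] := meet_ptP kF jF kj.
by apply: meet_pt_uniq => //; rewrite setUAC.
Qed.

Lemma tri_sym j k : j \notin F -> k \notin F -> j != k -> tri j k = tri k j.
Proof. by move=> jF kF jk; rewrite /tri (meet_pt_sym jF kF jk) setUAC. Qed.

Lemma meet_pt_id j i : i \in F -> meet_pt j i = i.
Proof. by rewrite /meet_pt => ->. Qed.

Lemma spec_coef_id j i : i \in F -> spec_coef j i = 1.
Proof. by rewrite /spec_coef => ->. Qed.

Lemma spec_coef_diag j : j \notin F -> spec_coef j j = 0.
Proof. by rewrite /spec_coef => /negPf ->; rewrite eqxx. Qed.

Lemma spec_coefE j k : j \notin F -> k \notin F -> j != k ->
  spec_coef j k = - q * sg (tri j k) (meet_pt j k) * sg (tri j k) k.
Proof. by rewrite /spec_coef => _ /negPf -> /negPf ->. Qed.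

Lemma spec_coefE' j k : j \notin F -> k \notin F -> j != k ->
  spec_coef k j = - q * sg (tri j k) (meet_pt j k) * sg (tri j k) j.
Proof.
by move=> jF kF jk; rewrite spec_coefE 1?eq_sym // -tri_sym // -meet_pt_sym.
Qed.

Lemma sorted_enum_perm X s : uniq s -> s =i X -> perm_eq (sorted_enum X) s.
Proof.
move=> us sX; rewrite /sorted_enum perm_sort; apply: uniq_perm; rewrite ?enum_uniq //.
by move=> x; rewrite mem_enum sX.
Qed.

Lemma circuit_rel_list X s phi : qcomm q phi -> uniq s -> s =i X ->
  (ev (circuit_rel X) phi = 0) <-> (ev (qder q (sg X) s) phi = 0).
Proof.
move=> Qphi us sX.
have [a a2 /(_ _ Qphi) [_ E]] := qder_perm q2 (sg X) (sorted_enum_perm us sX).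
rewrite /circuit_rel E; split=> [H|->]; last by rewrite mulr0.
by rewrite -[LHS]mul1r -a2 -mulrA H mulr0.
Qed.

Lemma flat_rels_homog r : flat_rels r -> exists d, homog d.+2 r.
Proof.
case=> X [XC _ ->]; have := qder_size q (sg X) (sorted_enum X).
rewrite size_sort -cardE; have := circuit_card XC.
by case: #|X| => [|[|[|m]]] // _ H; exists m.
Qed.

Lemma flat_relsF r : flat_rels r -> all (fun x => all (mem F) x.2) r.
Proof.
case=> X [XC XF ->]; apply: qder_all; apply/allP => x.
by rewrite mem_sort mem_enum => /(subsetP XF).
Qed.

(** Let p, p', i be the points of F on the lines jk, jl, kl. If two coincide, so does the third and
    all three words contain a square. Otherwise {p, p', i} is a circuit in F, and the claim is its
    relation with signs computed by elimination. *)
Lemma plane_rel_signed chi : annB' chi -> forall u w j k l,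
  j \notin F -> k \notin F -> l \notin F -> j != k -> j != l -> k != l ->
  spec_coef j k * spec_coef j l * chi (u ++ meet_pt j k :: meet_pt j l :: w) =
  spec_coef k l * spec_coef j k * chi (u ++ meet_pt j k :: meet_pt k l :: w) +
  spec_coef l k * spec_coef j l * chi (u ++ meet_pt k l :: meet_pt j l :: w).
Proof.
move=> [_ [hq hs] hQ] u w j k l jF kF lF jk jl kl.
have [pF pC] := meet_ptP jF kF jk; have [p'F p'C] := meet_ptP jF lF jl.
have [iF iC] := meet_ptP kF lF kl.
have lk : l != k by rewrite eq_sym.
have kj : k != j by rewrite eq_sym.
have lj : l != j by rewrite eq_sym.
set p := meet_pt j k; set p' := meet_pt j l; set i := meet_pt k l.
rewrite -/p -/p' -/i in pF pC p'F p'C iF iC *.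
have collinear a b c : a \notin F -> b \notin F -> c \notin F ->
    a != b -> a != c -> b != c -> meet_pt a b = meet_pt a c -> meet_pt b c = meet_pt a b.
  move=> aF bF cF ab ac bc e; apply: meet_pt_uniq => //.
    by have [] := meet_ptP aF bF ab.
  have [xF xC] := meet_ptP aF bF ab; have [_ yC] := meet_ptP aF cF ac.
  have ne : tri a b != tri a c.
    apply/negP => /eqP E; have : b \in tri a c by rewrite -E !inE eqxx orbT.
    rewrite !inE [b == a]eq_sym (negPf ab) (negPf bc) !orbF => /eqP eb.
    by rewrite eb -e xF in bF.
  have [||Z [ZC ZS] _] := sg_elim (e := a) xC yC ne; rewrite ?inE ?eqxx ?orbT //.
  rewrite -(@circuit_card3 Z _ _ _ ZC) //; apply: subset_trans ZS _.
  apply/subsetP => x; rewrite !inE -e.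
  by case: (x == a) => //=; case: (x == b); case: (x == c); case: (x == _).
have [epp'|npp'] := eqVneq p p'.
  have ei : i = p by apply: collinear.
  by rewrite ei -epp' !hs !mulr0 addr0.
have [epi|npi] := eqVneq p i.
  have e : meet_pt k j = meet_pt k l by rewrite -meet_pt_sym.
  by case/eqP: npp'; rewrite /p' (collinear k j l) // /p meet_pt_sym.
have [epi'|npi'] := eqVneq p' i.
  have e : meet_pt l j = meet_pt l k by rewrite -meet_pt_sym // -[RHS]meet_pt_sym.
  by case/eqP: npp'; rewrite /p (collinear l j k) // /p' meet_pt_sym.
have offF x y : x \in F -> y \notin F -> x != y.
  by move=> xF yF; apply: contraNneq yF => <-.
have [nkp nlp] : k != p /\ l != p by split; rewrite eq_sym offF.
have [nkp' nlp'] : k != p' /\ l != p' by split; rewrite eq_sym offF.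
have [nki nli] : k != i /\ l != i by split; rewrite eq_sym offF.
(* Eliminating j from the triangles jk and jl leaves the four-point circuit {p, p', k, l}. *)
have nAB : tri j k != tri j l.
  apply/negP => /eqP E; have : k \in tri j l by rewrite -E !inE eqxx orbT.
  by rewrite !inE (negPf kl) (negPf kj) (negPf nkp').
have [||Z1 [Z1C Z1S] [a1 [a12 sA sB]]] := sg_elim (e := j) pC p'C nAB;
  rewrite ?inE ?eqxx ?orbT //.
have Z1sub x : x \in Z1 -> [|| x == p, x == p', x == k | x == l].
  move/(subsetP Z1S); rewrite !inE; case: (x == j) => //=; rewrite ?orbF.
  by case/orP => /orP [] ->; rewrite ?orbT.
have kZ1 : k \in Z1.
  apply/negPn/negP => nk.
  have lZ : l \notin Z1.
    apply: circuit_off1 => //; apply/subsetP => x; rewrite !inE => /andP [xl xZ].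
    have := Z1sub x xZ; rewrite (negPf xl) orbF => /or3P [] /eqP ex; rewrite ?ex //.
    by rewrite ex (negPf nk) in xZ.
  apply: (@circuit_not2 Z1 p p') => //; apply/subsetP => x xZ; rewrite !inE.
  have := Z1sub x xZ; case: eqP => //= _; case: eqP => //= _ /orP [] /eqP ex.
    by rewrite ex (negPf nk) in xZ.
  by rewrite ex (negPf lZ) in xZ.
have lZ1 : l \in Z1.
  apply: contraTT kZ1 => nl; apply: circuit_off1 => //.
  apply/subsetP => x; rewrite !inE => /andP [xk xZ].
  have := Z1sub x xZ; rewrite (negPf xk) => /or3P [] // /eqP ex; rewrite ?ex //.
  by rewrite ex (negPf nl) in xZ.
have pZ1 : p \in Z1.
  apply/negPn/negP => nZ; case/eqP: npi'.
  symmetry; apply: meet_pt_uniq => //; rewrite -(circuit_card3 Z1C) //.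
  apply/subsetP => x xZ; have := Z1sub x xZ; rewrite !inE -!orbA; case: eqP => // ex _.
  by rewrite -ex xZ in nZ.
have p'Z1 : p' \in Z1.
  apply/negPn/negP => nZ; case/eqP: npi.
  symmetry; apply: meet_pt_uniq => //; rewrite -(circuit_card3 Z1C) //.
  apply/subsetP => x xZ; have := Z1sub x xZ; rewrite !inE -!orbA; case: (x == p) => //=.
  by case: eqP => // ex _; rewrite -ex xZ in nZ.
have nZD : Z1 != tri k l.
  apply/negP => /eqP E; move: pZ1; rewrite E !inE (negPf npi) /=.
  by case/orP => /eqP e; move: (pF); rewrite e ?(negPf kF) ?(negPf lF).
have ZpD : p \notin tri k l.
  by rewrite !inE !negb_or npi ![p == _]eq_sym nkp nlp.
have Zp'D : p' \notin tri k l.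
  by rewrite !inE !negb_or npi' ![p' == _]eq_sym nkp' nlp'.
have iZ1 : i \notin Z1.
  apply/negP => /Z1sub; rewrite ![i == _]eq_sym (negPf npi) (negPf npi').
  by rewrite (negPf nki) (negPf nli).
(* Eliminating k or l from this circuit and the triangle kl gives {p, p', i}. Both eliminations are
   used: comparing them relates the signs of [Z1] at k and at l. *)
have finish e : (e == k) || (e == l) -> exists2 a : K, a * a = 1 &
    [set p; p'; i] \in C /\
    [/\ a * sg [set p; p'; i] p = sg Z1 p,
        a * sg [set p; p'; i] p' = sg Z1 p' &
        a * sg [set p; p'; i] i = - q * sg Z1 e * sg (tri k l) e * sg (tri k l) i].
  move=> ekl.
  have [||Z [ZC ZS] [a [a2 s1 s2]]] := sg_elim (e := e) Z1C iC nZD.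
  - by case/orP: ekl => /eqP ->.
  - by case/orP: ekl => /eqP ->; rewrite !inE eqxx ?orbT.
  have ZE : Z = [set p; p'; i].
    apply: circuit_card3 => //.
    have Zsub x : x \in Z -> x != e /\ [|| x == p, x == p', x == i, x == k | x == l].
      move/(subsetP ZS); rewrite !inE => /andP [xe xZ]; split=> //.
      case/orP: xZ => [/Z1sub /or4P []|/orP [/orP []|]] ->; rewrite ?orbT //.
    have [m [ekl' mF]] : exists m, (forall x, (x == k) || (x == l) = (x == e) || (x == m))
        /\ m \notin F.
      by case/orP: ekl => /eqP ->; [exists l|exists k] => //; split=> // x; rewrite orbC.
    have mZ : m \notin Z.
      apply: circuit_off1 => //; apply/subsetP => x; rewrite !inE => /andP [xm xZ].
      have [xe] := Zsub x xZ; rewrite ekl' (negPf xe) (negPf xm) !orbF.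
      by case/or3P => /eqP ->.
    apply/subsetP => x xZ; have [xe] := Zsub x xZ; rewrite ekl' (negPf xe) /= !inE -!orbA.
    have -> : (x == m) = false by apply: contraNF mZ => /eqP <-.
    by rewrite orbF.
  rewrite ZE in ZC s1 s2; exists a => //; split=> //; split.
  - by apply: s1; rewrite // !inE eqxx.
  - by apply: s1; rewrite // !inE eqxx orbT.
  - by apply: s2; rewrite // !inE eqxx orbT.
have [a a2 [ZC [ap ap' aik]]] := finish k ltac:(by rewrite eqxx).
have [b b2 [_ [bp _ bil]]] := finish l ltac:(by rewrite eqxx orbT).
set Z := [set p; p'; i] in ZC ap ap' aik bp bil.
have ZF : Z \subset F by apply/subsetP => x; rewrite !inE => /orP [/orP [] /eqP ->|/eqP ->].
pose phi z := chi (u ++ z ++ w).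
have Qphi : qcomm q phi.
  split=> [v x y z|v x z]; rewrite /phi -!catA /=.
    by have := hq (u ++ v) x y (z ++ w); rewrite -!catA.
  by have := hs (u ++ v) x (z ++ w); rewrite -!catA.
have ul : uniq [:: p; p'; i] by rewrite /= !inE negb_or npp' npi npi'.
have Zl : [:: p; p'; i] =i Z by move=> x; rewrite !inE orbA.
have := hQ _ (ex_intro _ Z (And3 ZC ZF erefl)) u w.
move/(circuit_rel_list Qphi ul Zl); rewrite !ev_qder_cons ev_qder_nil.
rewrite /phi /= (hq u i p').
rewrite spec_coefE // spec_coefE // [spec_coef k l]spec_coefE //.
rewrite (spec_coefE' kF lF kl) -/p -/p' -/i.
have pT : p \in tri j k by rewrite !inE eqxx.
have kT : k \in tri j k by rewrite !inE eqxx orbT.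
have jT : j \in tri j k by rewrite !inE eqxx orbT.
have p'T : p' \in tri j l by rewrite !inE eqxx.
have lT : l \in tri j l by rewrite !inE eqxx orbT.
have jT' : j \in tri j l by rewrite !inE eqxx orbT.
have iT : i \in tri k l by rewrite !inE eqxx.
have kT' : k \in tri k l by rewrite !inE eqxx orbT.
have lT' : l \in tri k l by rewrite !inE eqxx orbT.
have pZ : p \in Z by rewrite !inE eqxx.
have iZ : i \in Z by rewrite !inE eqxx orbT.
have npT' : p \notin tri j l by rewrite !inE !negb_or npp' ![p == _]eq_sym nlp eq_sym offF.
have nkT' : k \notin tri j l by rewrite !inE !negb_or nkp' kj kl.
have np'T : p' \notin tri j k.
  by rewrite !inE !negb_or [p' == p]eq_sym npp' ![p' == _]eq_sym nkp' eq_sym offF.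
have nlT : l \notin tri j k by rewrite !inE !negb_or nlp lj lk.
move: (sA p pZ1 npT') (sA k kZ1 nkT') (sB p' p'Z1 np'T) (sB l lZ1 nlT).
move: (sg2 pC pT) (sg2 pC kT) (sg2 pC jT) (sg2 p'C p'T) (sg2 p'C lT) (sg2 p'C jT').
move: (sg2 iC iT) (sg2 iC kT') (sg2 iC lT') (sg2 ZC pZ) (sg2 ZC iZ).
move: ap ap' aik bp bil.
move: (sg (tri j k) p) (sg (tri j k) j) (sg (tri j k) k) => ap aj ak.
move: (sg (tri j l) p') (sg (tri j l) j) (sg (tri j l) l) => bp' bj bl.
move: (sg (tri k l) i) (sg (tri k l) k) (sg (tri k l) l) => di dk dl.
move: (sg Z p) (sg Z p') (sg Z i) => zp zp' zi.
move: (sg Z1 p) (sg Z1 p') (sg Z1 k) (sg Z1 l) => yp yp' yk yl.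
(* In this order, the values of [chi] at p p', p i and p' i. *)
move: (chi _) (chi _) (chi _) => X1 X2 X3.
move=> azp azp' azi bzp bzi di2 dk2 dl2 zp2 zi2 ap2 ak2 aj2 bp2 bl2 bj2 e1 e2 e3 e4 R.
(* Both eliminations keep the sign of [Z1] at p, so their scaling signs coincide; their values at i
   then give [eyk]. *)
have eab : a = b.
  transitivity (a * zp * zp); first by ring: zp2.
  by rewrite azp -bzp; ring: zp2.
have eyk : yk = yl * dl * dk.
  transitivity (- q * di * dk * (- q * yk * dk * di)); first by ring: q2 dk2 di2.
  by rewrite -azi eab bzi; ring: q2 di2.
have eak : ak = - q * aj * bj * bl * dl * dk.
  by rewrite -e2 eyk !mulrA e4.
have X3E : X3 = ap * (aj * bj * bp' * X2 + q * ak * dk * di * X1).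
  have : a1 * a * (zp * X3 + q * (zp' * X2 + q * (zi * X1 + q * 0))) = 0.
    by rewrite R mulr0.
  have -> : a1 * a * (zp * X3 + q * (zp' * X2 + q * (zi * X1 + q * 0))) =
    a1 * (a * zp) * X3 + q * (a1 * (a * zp')) * X2 + q * q * (a1 * (a * zi)) * X1 by ring.
  rewrite azp azp' azi e1 e3 (_ : a1 * _ = - q * (a1 * yk) * dk * di); last by ring.
  rewrite e2 => E.
  transitivity (ap * (ap * X3)); first by ring: ap2.
  congr (_ * _); apply/eqP; rewrite -subr_eq0 -E; apply/eqP; ring: q2.
by rewrite X3E eak; ring: q2 ap2 aj2 bj2 bl2 bp2 di2 dk2 dl2.
Qed.

Lemma annA_context phi u w : annA' phi -> annA' (fun z => phi (u ++ z ++ w)).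
Proof.
case=> [[h1 h2] h3 h4]; split; first split.
- by move=> v a b z; have := h1 (u ++ v) a b (z ++ w); rewrite -!catA.
- by move=> v a z; have := h2 (u ++ v) a (z ++ w); rewrite -!catA.
- by move=> v z j k jF kF jk; have := h3 (u ++ v) (z ++ w) j k jF kF jk; rewrite -!catA.
- move=> r Qr v z; rewrite -[RHS](h4 r Qr (u ++ v) (z ++ w)).
  by apply: eq_ev => y; rewrite -!catA.
Qed.

(* Induction on the number of elements of X off F: with j, k in X off F and
   i the point of F on their line, j k = al_jk j i + al_kj i k rewrites the
   relation of X in terms of circuits contained in X - j + i and X - k + i. *)
Lemma circuit_annA phi X : annA' phi -> X \in C -> ev (circuit_rel X) phi = 0.
Proof.
have [m] := ubnP #|X :\: F|; elim: m X phi => // m IH X phi ltm Aphi XC.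
have [XF|/(circuit_two_off XC)] := boolP (X \subset F).
  have [_ _ /(_ (circuit_rel X)) H] := Aphi.
  rewrite -[RHS](H _ [::] [::]); last by exists X.
  by apply: eq_ev => z; rewrite cats0.
case=> j [k [jX kX jF kF jk]].
have [iF TC] := meet_ptP jF kF jk; set i := meet_pt j k in iF TC.
have [Qphi hT _] := Aphi.
have kj : k != j by rewrite eq_sym.
have ij : i != j by apply: contraNneq jF => <-.
have ik : i != k by apply: contraNneq kF => <-.
have ji : j != i by rewrite eq_sym.
have ki : k != i by rewrite eq_sym.
have iT : i \in tri j k by rewrite !inE eqxx.
have jT : j \in tri j k by rewrite !inE eqxx orbT.
have kT : k \in tri j k by rewrite !inE eqxx orbT.
have [ai2 aj2 ak2] := And3 (sg2 TC iT) (sg2 TC jT) (sg2 TC kT).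
have hTT z : phi [:: j, k & z] = spec_coef j k * phi [:: j, i & z] +
                                 spec_coef k j * phi [:: i, k & z].
  exact: (hT [::]).
have hq a b z : phi [:: a, b & z] = q * phi [:: b, a & z].
  by case: Qphi => h _; apply: (h [::]).
rewrite (spec_coefE jF kF jk) (spec_coefE' jF kF jk) -/i in hTT.
have [XT|nXT] := eqVneq X (tri j k).
  rewrite XT; apply/(circuit_rel_list (s := [:: i; j; k]) Qphi).
  - by rewrite /= !inE negb_or ij ik jk.
  - by move=> x; rewrite !inE orbA.
  rewrite !ev_qder_cons ev_qder_nil hTT (hq j i).
  by ring: q2 ai2.
have iX : i \notin X.
  apply/negP => iX; case/eqP: nXT; symmetry; apply: circuit_incl => //.
  by apply/subsetP => x; rewrite !inE => /orP [/orP [] /eqP ->|/eqP ->].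
pose Y := X :\ j :\ k.
have YT x : x \in Y -> [/\ x != i, x != j, x != k, x \in X & x \notin tri j k].
  rewrite !inE => /and3P [xk xj xX]; have xi : x != i by apply: contraNneq iX => <-.
  by rewrite xk xj xX (negPf xi) (negPf xj) (negPf xk).
have XE x : x \in X = [|| x == j, x == k | x \in Y].
  rewrite !inE; have [->|_] := eqVneq x j; first by rewrite jX.
  by have [->|_] := eqVneq x k; rewrite ?kX.
(* Eliminating e from X and the triangle gives a circuit Z inside Y + i + f. It contains Y because
   eliminating i from Z and the triangle recovers X. Whether it contains f distinguishes the two
   cases below. *)
have key e f : (e == j) && (f == k) || (e == k) && (f == j) ->
    exists Z, [/\ Z \in C, i \in Z, {subset Y <= Z}, e \notin Z &
     (forall x, x \in Z -> [|| x == i, x == f | x \in Y]) /\ exists a : K,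
     [/\ a * a = 1, {in Y, forall y, a * sg Z y = sg X y} &
       a * sg Z i = - q * sg X e * sg (tri j k) e * sg (tri j k) i]].
  move=> ef; have [eX eT] : e \in X /\ e \in tri j k.
    by case/orP: ef => /andP [/eqP -> _].
  have fX : f \in X by case/orP: ef => /andP [_ /eqP ->].
  have [Z [ZC ZS] [a [a2 s1 s2]]] := sg_elim XC TC nXT eX eT.
  have eZ : e \notin Z by apply/negP => /(subsetP ZS); rewrite !inE eqxx.
  have Zsub x : x \in Z -> [|| x == i, x == f | x \in Y].
    move=> xZ; have := subsetP ZS x xZ; rewrite in_setD1 in_setU XE => /andP [xe].
    rewrite !in_setU !in_set1 -/i.
    case/orP: ef xe => /andP [/eqP -> /eqP ->] xe; rewrite (negPf xe) /=;
    by case: (x == i); case: (x == j); case: (x == k); rewrite ?orbT ?orbF.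
  have iZ : i \in Z.
    apply: contraNT eZ => niZ; suff -> : Z = X by [].
    apply: circuit_incl => //; apply/subsetP => x xZ; case/or3P: (Zsub x xZ).
    - by move/eqP => ex; rewrite -ex xZ in niZ.
    - by move/eqP => ->.
    - by case/YT.
  have nZT : Z != tri j k by apply: contraNneq eZ => ->.
  have [W [WC WS] _] := sg_elim ZC TC nZT iZ iT.
  have WX : W = X.
    apply: circuit_incl => //; apply/subsetP => x xW.
    have := subsetP WS x xW; rewrite in_setD1 in_setU XE => /andP [xi].
    rewrite !in_setU !in_set1 -/i (negPf xi) /=.
    case/orP => [/Zsub|/orP [] ->]; rewrite ?orbT // (negPf xi) /=.
    by case/orP: ef => /andP [_ /eqP ->] /orP [] ->; rewrite ?orbT.
  have YZ : {subset Y <= Z}.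
    move=> y yY; have [yi yj yk yX yT] := YT y yY.
    have := subsetP WS y; rewrite WX yX => /(_ isT); rewrite in_setD1 in_setU (negPf yT).
    by rewrite orbF => /andP [].
  exists Z; split=> //; split=> //.
  exists a; split=> //.
    by move=> y yY; have [_ _ _ _ yT] := YT y yY; apply: s1 => //; apply: YZ.
  exact: s2.
have [Z1 [Z1C iZ1 YZ1 jZ1 [Z1S [a [a2 s1 ai]]]]] := key j k ltac:(by rewrite !eqxx).
have [Z2 [Z2C iZ2 YZ2 kZ2 [Z2S [b [b2 s2 bi]]]]] := key k j ltac:(by rewrite !eqxx orbT).
have lt_off Z f g : (forall x, x \in Z -> [|| x == i, x == f | x \in Y]) ->
    f \in X -> g \in X -> g \notin F -> g \notin Z -> (#|Z :\: F| < m)%N.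
  move=> ZS fX gX gF gZ; rewrite -ltnS; apply: leq_trans ltm; rewrite ltnS.
  apply: proper_card; apply/properP; split; last first.
    by exists g; rewrite !inE ?gF // (negPf gZ) andbF.
  apply/subsetP => x; rewrite !in_setD => /andP [xF xZ]; rewrite xF /=.
  have := ZS x xZ => /or3P [/eqP ex|/eqP ->|/YT []] //.
  by rewrite ex iF in xF.
have R1 := IH Z1 phi (lt_off _ _ _ Z1S kX jX jF jZ1) Aphi Z1C.
have R2 := IH Z2 phi (lt_off _ _ _ Z2S jX kX kF kZ2) Aphi Z2C.
pose y := enum Y.
have uy : uniq y by apply: enum_uniq.
have yY x : x \in y = (x \in Y) by rewrite mem_enum.
have niY : i \notin Y by apply/negP => /YT []; rewrite eqxx.
have njY : j \notin Y by rewrite !inE eqxx andbF.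
have nkY : k \notin Y by rewrite !inE eqxx.
pose D a b := ev (qder q (sg X) y) (fun z => phi [:: a, b & z]).
have scale Z (c : K) a1 a2' : {in Y, forall y, c * sg Z y = sg X y} ->
    c * ev (qder q (sg Z) y) (fun z => phi [:: a1, a2' & z]) = D a1 a2'.
  move=> sc; rewrite /D -(@ev_qder_scale _ _ _ c (sg X)) //.
  by move=> x; rewrite yY => /sc.
apply/(circuit_rel_list (s := [:: j, k & y]) Qphi).
- by rewrite /= inE negb_or jk !yY njY nkY uy.
- by move=> x; rewrite !inE yY XE !inE.
rewrite !ev_qder_cons.
have -> : ev (qder q (sg X) y) (fun z => phi [:: j, k & z]) =
   - q * sg (tri j k) i * sg (tri j k) k * D j i +
   - q * sg (tri j k) i * sg (tri j k) j * (q * D k i).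
  rewrite /D -!evZ -evD; apply: eq_ev => z.
  by rewrite hTT (hq i k).
(* If k is not in [Z1], then [Z1] = [Z2] = Y + i has one element less than X, and its relation is
   used twice, multiplied by x_j and by x_k. *)
have [kZ1|kZ1] := boolP (k \in Z1); last first.
  have Z1E x : x \in Z1 -> (x == i) || (x \in Y).
    move=> xZ; have := Z1S x xZ; rewrite inE /= => /orP [->//|/orP [/eqP ex|->]];
    by rewrite ?orbT //; rewrite -ex xZ in kZ1.
  have Z12 : Z1 = Z2.
    by apply: circuit_incl => //; apply/subsetP => x /Z1E /orP [/eqP ->|/YZ2].
  have [y0 y0Y] : exists y0, y0 \in Y.
    apply/set0Pn; apply: contraTneq (circuit_card Z1C) => Y0.
    rewrite -leqNgt; apply: (@leq_trans #|[set i]|); last by rewrite cards1.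
    by apply/subset_leq_card/subsetP => x /Z1E; rewrite Y0 !inE orbF.
  have eab : a = b.
    have z2 := sg2 Z1C (YZ1 _ y0Y).
    transitivity (a * sg Z1 y0 * sg Z1 y0); first by ring: z2.
    by rewrite s1 // -s2 // -Z12; ring: z2.
  have lin c : c \in [:: j; k] ->
      q * D c i = - (a * sg Z1 i) * phi (c :: y).
    move=> cjk; have Ac := annA_cons c Aphi; have [Qc _ _] := Ac.
    have := IH Z1 _ (lt_off _ _ _ Z1S kX jX jF jZ1) Ac Z1C.
    move/(circuit_rel_list (s := i :: y) Qc) => R.
    have {}R := R ltac:(by rewrite /= yY niY uy)
      ltac:(by move=> x; rewrite inE yY; apply/idP/idP => [/orP [/eqP ->|/YZ1]|/Z1E]).
    rewrite ev_qder_cons in R; rewrite -(scale _ _ c i s1).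
    by apply/eqP; rewrite -subr_eq0 -(mulr0 a) -R; apply/eqP; ring.
  have Lj := lin j ltac:(by rewrite inE eqxx).
  have Lk := lin k ltac:(by rewrite !inE eqxx orbT).
  rewrite ai in Lk; rewrite eab Z12 bi in Lj; rewrite Lk.
  transitivity (sg X j * phi (k :: y) + q * (sg X k * phi (j :: y)) +
    - q * sg (tri j k) i * sg (tri j k) k * (q * (q * D j i)) +
    - q * sg (tri j k) i * sg (tri j k) j * (q * q * (q * D k i))); first by rewrite Lk; ring.
  by rewrite Lj Lk; ring: q2 ai2 aj2 ak2.
have jZ2 : j \in Z2.
  apply: contraTT kZ1 => nj.
  suff -> : Z1 = Z2 by [].
  symmetry; apply: circuit_incl => //; apply/subsetP => x xZ.
  case/or3P: (Z2S x xZ) => [/eqP -> //|/eqP ex|/YZ1 //].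
  by rewrite -ex xZ in nj.
have [y0 y0Y] : exists y0, y0 \in Y.
  apply/set0Pn/negP => /eqP Y0; apply: (@circuit_not2 X j k) => //.
  by apply/subsetP => x; rewrite XE Y0 !inE orbF.
have [y01 y02] := conj (YZ1 _ y0Y) (YZ2 _ y0Y).
have nZ : Z1 != Z2 by apply: contraNneq jZ1 => ->.
(* Now [Z1] = Y + i + k and [Z2] = Y + i + j. Eliminating a common [y0] must give back the triangle,
   which ties its signs at j and k to those of [Z1] at k and [Z2] at j. *)
have [V [VC VS] [e [e2 ek ej]]] := sg_elim Z1C Z2C nZ y01 y02.
have y0V : y0 \notin V by apply/negP => /(subsetP VS); rewrite !inE eqxx.
have Vsub x : x \in V -> [|| x == i, x == j, x == k | x \in Y].
  move/(subsetP VS); rewrite in_setD1 in_setU => /andP [_].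
  by case/orP => [/Z1S|/Z2S] /or3P [] ->; rewrite ?orbT.
have iV : i \in V.
  apply: contraNT y0V => ni; suff -> : V = X by rewrite XE y0Y !orbT.
  apply: circuit_incl => //; apply/subsetP => x xV; rewrite XE.
  by case/or4P: (Vsub x xV) => [/eqP ex|->|->|->]; rewrite ?orbT //; rewrite -ex xV in ni.
have jV : j \in V.
  apply: contraNT y0V => nj; suff -> : V = Z1 by [].
  apply: circuit_incl => //; apply/subsetP => x xV.
  case/or4P: (Vsub x xV) => [/eqP ->|/eqP ex|/eqP ->|/YZ1] //.
  by rewrite -ex xV in nj.
have kV : k \in V.
  apply: contraNT y0V => nk; suff -> : V = Z2 by [].
  apply: circuit_incl => //; apply/subsetP => x xV.
  case/or4P: (Vsub x xV) => [/eqP ->|/eqP ->|/eqP ex|/YZ2] //.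
  by rewrite -ex xV in nk.
have VT : V = tri j k.
  symmetry; apply: circuit_incl => //.
  by apply/subsetP => x; rewrite !inE => /orP [/orP [] /eqP ->|/eqP ->].
have {}ek := ek k kV kZ2; have {}ej := ej j jV jZ1; rewrite VT in ek ej.
have yl1 : uniq [:: k, i & y] by rewrite /= inE negb_or ki !yY niY nkY uy.
have ye1 : [:: k, i & y] =i Z1.
  move=> x; rewrite !inE yY; apply/idP/idP => [/or3P [/eqP ->|/eqP ->|/YZ1]|/Z1S] //.
  by case/or3P=> ->; rewrite ?orbT.
have yl2 : uniq [:: j, i & y] by rewrite /= inE negb_or ji !yY niY njY uy.
have ye2 : [:: j, i & y] =i Z2.
  move=> x; rewrite !inE yY; apply/idP/idP => [/or3P [/eqP ->|/eqP ->|/YZ2]|/Z2S] //.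
  by case/or3P=> ->; rewrite ?orbT.
move/(circuit_rel_list Qphi yl1 ye1): R1; rewrite !ev_qder_cons => R1.
move/(circuit_rel_list Qphi yl2 ye2): R2; rewrite !ev_qder_cons => R2.
have Ek : D k i = - (a * sg Z1 k * phi (i :: y) + q * (a * sg Z1 i) * phi (k :: y)).
  rewrite -(scale _ _ k i s1); apply/eqP; rewrite -subr_eq0 -(mulr0 a) -R1; apply/eqP.
  by ring: q2.
have Ej : D j i = - (b * sg Z2 j * phi (i :: y) + q * (b * sg Z2 i) * phi (j :: y)).
  rewrite -(scale _ _ j i s2); apply/eqP; rewrite -subr_eq0 -(mulr0 b) -R2; apply/eqP.
  by ring: q2.
rewrite Ek Ej ai bi.
have {s1 s2} := (s1 y0 y0Y, s2 y0 y0Y) => -[s1 s2].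
have y0X : y0 \in X by rewrite XE y0Y !orbT.
move: (sg2 XC y0X) (sg2 Z1C kZ1) => x02 zk2.
have e0 : sg Z1 y0 * sg Z2 y0 = a * b.
  transitivity (a * b * ((a * sg Z1 y0) * (b * sg Z2 y0))); first by ring: a2 b2.
  by rewrite s1 s2; ring: x02.
have eaj : sg (tri j k) j = - q * sg (tri j k) k * (a * sg Z1 k) * (b * sg Z2 j).
  transitivity (e * (e * sg (tri j k) j)); first by ring: e2.
  transitivity (- q * e * (sg Z1 y0 * sg Z2 y0) * sg Z2 j); first by rewrite ej; ring.
  by rewrite e0 -ek; ring: ak2.
have g2 : (a * sg Z1 k) * (a * sg Z1 k) = 1 by ring: a2 zk2.
have g2' : (b * sg Z2 j) * (b * sg Z2 j) = 1.
  by have zj2 := sg2 Z2C jZ2; ring: b2 zj2.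
move: eaj g2 g2' ai2 ak2 aj2.
move: (a * sg Z1 k) (b * sg Z2 j) (phi (i :: y)) (phi (j :: y)) (phi (k :: y)) => g g' S R P.
move: (sg (tri j k) i) (sg (tri j k) j) (sg (tri j k) k) => ti tj tk -> g2 g2' ti2 tk2 _.
by ring: q2 g2 g2' ti2 tk2.
Qed.

Lemma annA_iff psi : annA' psi <-> qcomm q psi /\
  (forall X, X \in C -> forall u w, ev (circuit_rel X) (fun z => psi (u ++ z ++ w)) = 0).
Proof.
split=> [Apsi|[Qpsi H]].
  split; first by case: Apsi.
  by move=> X XC u w; apply: circuit_annA (annA_context u w Apsi) XC.
split=> // [u w j k jF kF jk|r [X [XC _ ->]] u w]; last exact: H.
have [iF TC] := meet_ptP jF kF jk.
rewrite (spec_coefE jF kF jk) (spec_coefE' jF kF jk).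
set i := meet_pt j k in iF TC *.
have iT : i \in tri j k by rewrite !inE eqxx.
have ai2 := sg2 TC iT.
have ij : i != j by apply: contraNneq jF => <-.
have ik : i != k by apply: contraNneq kF => <-.
have Qc : qcomm q (fun z => psi (u ++ z ++ w)).
  have [h1 h2] := Qpsi; split=> [v a b z|v a z].
    by have := h1 (u ++ v) a b (z ++ w); rewrite -!catA.
  by have := h2 (u ++ v) a (z ++ w); rewrite -!catA.
have := H _ TC u w; move/(circuit_rel_list (s := [:: i; j; k]) Qc) => R.
have {}R := R ltac:(by rewrite /= !inE negb_or ij ik jk)
  ltac:(by move=> x; rewrite !inE orbA).
rewrite !ev_qder_cons ev_qder_nil /= in R.
have [hq _] := Qpsi; rewrite (hq u j i).
move: R ai2; move: (psi _) (psi _) (psi _) => S1 S2 S3.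
move: (sg _ i) (sg _ j) (sg _ k) => ai aj ak R ai2.
apply/eqP; rewrite -subr_eq0 -(mulr0 ai) -R; apply/eqP.
by ring: q2 ai2.
Qed.

(** The global sign a of the image circuit enters [spec_coef] twice and cancels. *)
Lemma equivariant_signed (s : 'I_n -> 'I_n) (eps : 'I_n -> K) :
  injective s -> (forall i, (s i \in F) = (i \in F)) -> (forall i, eps i * eps i = 1) ->
  (forall X, X \in C -> s @: X \in C /\ exists2 a : K, a * a = 1 &
     {in X, forall c, sg (s @: X) (s c) = a * eps c * sg X c}) ->
  equivariant F meet_pt spec_coef (s, eps).
Proof.
move=> si sF e2 sC'; split=> //= j k jF kF jk.
have [iF TC] := meet_ptP jF kF jk.
have [sT [a a2 sa]] := sC' _ TC.
have sE : s @: tri j k = [set s (meet_pt j k); s j; s k].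
  by rewrite /tri !imsetU !imset_set1.
have ssF x : (s x \notin F) = (x \notin F) by rewrite sF.
have sjk : s j != s k by rewrite (inj_eq si).
have pE : meet_pt (s j) (s k) = s (meet_pt j k).
  by apply: meet_pt_uniq; rewrite ?sF ?ssF // -sE.
split=> //; rewrite !spec_coefE ?ssF // /tri pE -sE.
rewrite !sa ?inE ?eqxx ?orbT //.
by ring: a2.
Qed.

Theorem signed_ses acts (RA RB : fpoly K n -> Prop) :
  (forall r, RA r -> exists d, homog d r) -> (forall r, RB r -> exists d, homog d r) ->
  (forall psi, ann RA psi <-> qcomm q psi /\
    (forall X, X \in C -> forall u w, ev (circuit_rel X) (fun z => psi (u ++ z ++ w)) = 0)) ->
  (forall psi, ann RB psi <-> annB' psi) ->
  (forall h, acts h -> equivariant F meet_pt spec_coef h) ->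
  ses acts (ideal_mem RB) (ideal_mem RA) (XshiftB F RB) /\
  ses acts (XshiftB F (koszul_rels RA setT)) (ideal_mem (koszul_rels RA setT))
           (ideal_mem (koszul_rels RB F)).
Proof.
move=> hA hB NA NB eqv.
have DA : dualpair (ideal_mem RA) annA'.
  apply: dualpair_iff (ideal_dualpair hA) _ => psi.
  by rewrite NA annA_iff.
have DB : dualpair (ideal_mem RB) annB' by apply: dualpair_iff (ideal_dualpair hB) NB.
have KA psi : ann (koszul_rels RA setT) psi <-> annK F q meet_pt spec_coef flat_rels psi.
  rewrite (ann_koszul _ _ DA); split=> [[_ H] u w phi Aphi|H].
    by apply: H => // a b _; rewrite !inE.
  split=> [u i w|u w phi Aphi _]; first by rewrite inE.
  exact: H.
have KB psi : ann (koszul_rels RB F) psi <-> annKB F q flat_rels psi.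
  rewrite (ann_koszul _ _ DB); split=> [[H1 H2]|[H1 H2]]; split.
  - by move=> w /allPn [i /splitPr iw iF]; case: iw => u v; apply: H1.
  - move=> u w phi Bphi; apply: H2 => // a b; apply: contraNT => nab.
    by case: Bphi => h _ _; rewrite h //= andbT.
  - by move=> u i w iF; apply: H1; rewrite all_cat /= (negPf iF) andbF.
  - by move=> u w phi Bphi _; apply: H2.
have hK R S r := @koszul_rels_homog K n R S r.
have hin j k jF kF jk := (proj1 (@meet_ptP j k jF kF jk)).
split.
  apply: (residue_ses (q := q) (pi := meet_pt) (al := spec_coef)
           (Q := flat_rels)) DA DB _ eqv => //.
  - exact: meet_pt_id.
  - exact: spec_coef_id.
  - exact: spec_coef_diag.
  - exact: meet_pt_sym.
  - exact: flat_rels_homog.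
  - exact: flat_relsF.
  - exact: plane_rel_signed.
  - exact: shift_dualpair hB NB.
apply: (koszul_ses (q := q) (pi := meet_pt) (al := spec_coef) (Q := flat_rels)) _ _ _ eqv => //.
- exact: meet_pt_id.
- exact: spec_coef_id.
- exact: spec_coef_diag.
- exact: meet_pt_sym.
- exact: flat_rels_homog.
- exact: flat_relsF.
- exact: plane_rel_signed.
- by apply: shift_dualpair KA; apply: hK.
- by apply: dualpair_iff (ideal_dualpair _) KA; apply: hK.
- by apply: dualpair_iff (ideal_dualpair _) KB; apply: hK.
Qed.

End SignedCircuits.

(** * Orlik-Solomon and Varchenko-Gelfand relations in a common form *)

Section Presentations.
Set Implicit Arguments. Unset Strict Implicit. Unset Printing Implicit Defensive.
Variables (K : fieldType) (n : nat).
Implicit Types (S X Y : {set 'I_n}) (r : fpoly K n) (psi : seq 'I_n -> K).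

Definition presented (q : K) S (D : fpoly K n -> Prop) r : Prop :=
  [\/ exists i, i \notin S /\ r = [:: (1, [:: i])],
      exists i j, [/\ i \in S, j \in S & r = [:: (1, [:: i; j]); (- q, [:: j; i])]],
      exists i, i \in S /\ r = [:: (1, [:: i; i])] | D r].

(** A letter outside S kills a word, so the commutation rules, imposed only inside S, hold for all
    letters. *)
Lemma ann_presented q S D psi :
  ann (presented q S D) psi <-> [/\ offF S psi, qcomm q psi & ann D psi].
Proof.
split=> [H|[H1 [H2 H3] H4] r [[i [iS ->]]|[i [j [iS jS ->]]]|[i [iS ->]]|Dr] u w].
- have H1 : offF S psi.
    move=> w /allPn [i /splitPr iw iS]; case: iw => u v.
    have := H _ (Or41 _ _ _ (ex_intro _ i (conj iS erefl))) u v.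
    by rewrite !ev_simpl mul1r.
  split=> //; last by move=> r Dr; apply: H; apply: Or44.
  split=> [u a b w|u a w].
    case aS : (a \in S); last by rewrite !H1 ?mulr0 // all_cat /= aS ?andbF.
    case bS : (b \in S); last by rewrite !H1 ?mulr0 // all_cat /= bS ?andbF.
    have := H _ (Or42 _ _ _ (ex_intro _ a (ex_intro _ b (And3 aS bS erefl)))) u w.
    by rewrite !ev_simpl mul1r /= mulNr => /eqP; rewrite subr_eq0 => /eqP.
  case aS : (a \in S); last by rewrite !H1 // all_cat /= aS ?andbF.
  have := H _ (Or43 _ _ _ (ex_intro _ a (conj aS erefl))) u w.
  by rewrite !ev_simpl mul1r.
- by rewrite !ev_simpl H1 ?mulr0 // all_cat /= (negPf iS) andbF.
- by rewrite !ev_simpl mul1r /= (H2 u i j w) mulNr subrr.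
- by rewrite !ev_simpl /= H3 mulr0.
- exact: H4.
Qed.

Lemma presented_homog q S D : (forall r, D r -> exists d, homog d r) ->
  forall r, presented q S D r -> exists d, homog d r.
Proof.
move=> hD r [[i [_ ->]]|[i [j [_ _ ->]]]|[i [_ ->]]|/hD //].
- by exists 1%N.
- by exists 2%N.
- by exists 2%N.
Qed.

Lemma ann_iff (R R' : fpoly K n -> Prop) psi : (forall r, R r <-> R' r) ->
  ann R psi <-> ann R' psi.
Proof. by move=> E; split=> H r /E; apply: H. Qed.

Lemma sorted_enum_uniq S : uniq (sorted_enum S).
Proof. by rewrite sort_uniq enum_uniq. Qed.

Lemma mem_sorted_enum S x : (x \in sorted_enum S) = (x \in S).
Proof. by rewrite mem_sort mem_enum. Qed.

Lemma dOS_qder X : dOS K X = qder (-1) (fun=> 1) (sorted_enum X).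
Proof.
rewrite /dOS; elim: (sorted_enum X) => [|c s IH] //=.
rewrite expr0 /rem_at /= drop0 -IH -(addn0 1%N) iotaDl -!map_comp; congr (_ :: _).
by apply: eq_map => m /=; rewrite exprS.
Qed.

Definition sgn (Z : {set bool * 'I_n}) (c : 'I_n) : K := if c \in spos Z then 1 else -1.

Lemma dVG_qder (Z : {set bool * 'I_n}) :
  dVG K Z = qder 1 (sgn Z) (sorted_enum (ssupp Z)).
Proof.
rewrite /dVG; have := sorted_enum_uniq (ssupp Z).
elim: (sorted_enum _) => [|c s IH] //= /andP [cs us].
rewrite eqxx -IH // -map_comp; congr (_ :: _); apply/eq_in_map => x xs /=.
by rewrite mul1r; case: eqP xs cs => [->->|].
Qed.

Lemma OS_rels_presented (C : {set {set 'I_n}}) S r : OS_rels (K:=K) C S r <->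
  presented (-1) S (fun r => exists X, [/\ X \in C, X \subset S & r = dOS K X]) r.
Proof. by rewrite /presented opprK. Qed.

Lemma VG_rels_presented (SC : {set {set bool * 'I_n}}) S r : VG_rels (K:=K) SC S r <->
  presented 1 S (fun r => exists Z, [/\ Z \in SC, ssupp Z \subset S & r = dVG K Z]) r.
Proof. by []. Qed.

End Presentations.

(** * Signs of the circuits of an oriented matroid *)

Section OrientedMatroid.
Set Implicit Arguments. Unset Strict Implicit. Unset Printing Implicit Defensive.
Variables (K : fieldType) (n : nat) (SC : {set {set bool * 'I_n}}).
Hypothesis hS : oriented_matroid SC.
Implicit Types (Z : {set bool * 'I_n}) (X Y : {set 'I_n}).
Notation sgn := (sgn K).

Lemma sgn2 Z c : sgn Z c * sgn Z c = 1.
Proof. by rewrite /sgn; case: ifP => _; rewrite ?mulrNN mulr1. Qed.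

Lemma spos_sopp Z : spos (sopp Z) = sneg Z.
Proof.
apply/setP => x; rewrite !inE; apply/imsetP/idP => [[[b y] yZ /= [/eqP eb ->]]|xZ].
  by case: b yZ eb.
by exists (true, x).
Qed.

Lemma sneg_sopp Z : sneg (sopp Z) = spos Z.
Proof.
apply/setP => x; rewrite !inE; apply/imsetP/idP => [[[b y] yZ /= [/eqP eb ->]]|xZ].
  by case: b yZ eb.
by exists (false, x).
Qed.

Lemma ssupp_sopp Z : ssupp (sopp Z) = ssupp Z.
Proof. by rewrite /ssupp spos_sopp sneg_sopp setUC. Qed.

Lemma sneg_spos Z c : Z \in SC -> c \in ssupp Z -> (c \in sneg Z) = (c \notin spos Z).
Proof.
have [_ hd _ _ _] := hS; move=> /hd dZ; rewrite in_setU.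
case cp : (c \in spos Z) => /=; last by move=> ->.
by have := disjointFr dZ cp => ->.
Qed.

Lemma sgn_sopp Z c : Z \in SC -> c \in ssupp Z -> sgn (sopp Z) c = - sgn Z c.
Proof.
by move=> ZS cZ; rewrite /sgn spos_sopp sneg_spos //; case: (c \in spos Z); rewrite ?opprK.
Qed.

Lemma same_support Z Z' : Z \in SC -> Z' \in SC -> ssupp Z = ssupp Z' ->
  exists2 a : K, a * a = 1 & {in ssupp Z, forall c, sgn Z c = a * sgn Z' c}.
Proof.
move=> ZS ZS' E; have [_ _ _ hi _] := hS.
have [->|->] := hi Z Z' ZS ZS' ltac:(by rewrite E).
  by exists 1 => [|c _]; rewrite ?mulr1 ?mul1r.
exists (-1) => [|c]; first by rewrite mulrNN mulr1.
by rewrite ssupp_sopp => cZ; rewrite sgn_sopp // mulN1r.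
Qed.

(** A choice of signed circuit on X, immaterial up to a global sign by [same_support]; the default
    [set0] occurs only if X is not a circuit. *)
Definition repr_circuit X : {set bool * 'I_n} :=
  odflt set0 [pick Z in SC | ssupp Z == X].

Definition circuit_sgn X c : K := sgn (repr_circuit X) c.

Lemma repr_circuitP X : X \in underlying SC ->
  repr_circuit X \in SC /\ ssupp (repr_circuit X) = X.
Proof.
case/imsetP => Z ZS XE; rewrite /repr_circuit; case: pickP => [Z' /andP [Z'S /eqP E]//|H].
by have := H Z; rewrite ZS XE eqxx.
Qed.

Lemma circuit_sgnP Z : Z \in SC ->
  exists2 a : K, a * a = 1 & {in ssupp Z, forall c, sgn Z c = a * circuit_sgn (ssupp Z) c}.
Proof.
move=> ZS; have [RS RE] := repr_circuitP (imset_f _ ZS).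
exact: same_support.
Qed.

Lemma orient Z e : Z \in SC -> e \in ssupp Z ->
  exists Z', [/\ Z' \in SC, ssupp Z' = ssupp Z & e \in spos Z'].
Proof.
have [_ _ ho _ _] := hS; move=> ZS eZ; case ep : (e \in spos Z); first by exists Z.
by exists (sopp Z); rewrite ho // ssupp_sopp spos_sopp sneg_spos ?ep.
Qed.

Lemma orient_circuit X e : X \in underlying SC -> e \in X ->
  exists Z, [/\ Z \in SC, ssupp Z = X, e \in spos Z &
    {in X, forall c, sgn Z c = circuit_sgn X e * circuit_sgn X c}].
Proof.
case/imsetP => Z0 Z0S -> eX; have [Z [ZS ZE eZ]] := orient Z0S eX.
exists Z; split=> //; have [a a2] := circuit_sgnP ZS; rewrite ZE => sa.
have ae : a = circuit_sgn (ssupp Z0) e.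
  have := sa e eX; rewrite /sgn eZ => e1.
  have c2 := sgn2 (repr_circuit (ssupp Z0)) e; rewrite -/(circuit_sgn _ e) in c2.
  transitivity (a * circuit_sgn (ssupp Z0) e * circuit_sgn (ssupp Z0) e); first by ring: c2.
  by rewrite -e1 mul1r.
by move=> c cX; rewrite sa // -ae.
Qed.

(** Both circuits are oriented with e positive, and e is eliminated between the first and the
    opposite of the second. Off Y the result has the signs of the first, off X the opposite of those
    of the second. *)
Lemma circuit_sgn_elim X Y e : X \in underlying SC -> Y \in underlying SC -> X != Y ->
  e \in X -> e \in Y ->
  exists2 Z, Z \in underlying SC /\ Z \subset (X :|: Y) :\ e & exists a : K,
    [/\ a * a = 1, {in Z, forall z, z \notin Y -> a * circuit_sgn Z z = circuit_sgn X z} &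
        {in Z, forall z, z \notin X -> a * circuit_sgn Z z =
           - 1 * circuit_sgn X e * circuit_sgn Y e * circuit_sgn Y z}].
Proof.
have [h0 hd ho hi he] := hS.
move=> XC YC nXY eX eY.
have [Z1 [Z1S E1 e1 s1]] := orient_circuit XC eX.
have [Z2 [Z2S E2 e2 s2]] := orient_circuit YC eY.
have [||Z3 Z3S [H1 H2]] := he Z1 (sopp Z2) e Z1S (ho _ Z2S).
- apply: contraNneq nXY => E; rewrite -E1 -E2.
  by rewrite -(ssupp_sopp Z2) -(ssupp_sopp (sopp Z2)) E.
- by rewrite in_setI e1 sneg_sopp.
rewrite spos_sopp in H1; rewrite sneg_sopp in H2.
have sub x : x \in ssupp Z3 -> x != e /\ x \in X :|: Y.
  rewrite -E1 -E2 /ssupp 3!in_setU; case/orP => [/(subsetP H1)|/(subsetP H2)];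
  by rewrite in_setD1 in_setU => /andP [-> /orP [] xZ]; rewrite !in_setU xZ ?orbT.
have [a a2 sa] := circuit_sgnP Z3S.
exists (ssupp Z3); first split; first exact: imset_f.
  by apply/subsetP => x /sub [xe xXY]; rewrite in_setD1 xe.
have x2 : circuit_sgn X e * circuit_sgn X e = 1 by apply: sgn2.
have as_ z : z \in ssupp Z3 -> circuit_sgn (ssupp Z3) z = a * sgn Z3 z.
  by move=> zZ; rewrite sa //; ring: a2.
have pos Z z : z \in spos Z -> sgn Z z = 1 by rewrite /sgn => ->.
have neg Z z : Z \in SC -> z \in sneg Z -> sgn Z z = -1.
  by move=> ZS zn; rewrite /sgn; have := disjointFl (hd Z ZS) zn => ->.
have notin Z z : z \notin ssupp Z -> (z \in spos Z) = false /\ (z \in sneg Z) = false.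
  by rewrite in_setU negb_or => /andP [/negPf -> /negPf ->].
(* [a] compares [Z3] with the representative on its support, [circuit_sgn X e] compares [Z1] with
   that of X. *)
exists (a * circuit_sgn X e); split=> [|z zZ zY|z zZ zX]; first by ring: a2 x2.
  have [np nn] : (z \in spos Z2) = false /\ (z \in sneg Z2) = false.
    by apply: notin; rewrite E2.
  have E : sgn Z3 z = sgn Z1 z.
    move: zZ; rewrite in_setU => /orP [] z3.
      have := subsetP H1 z z3; rewrite in_setD1 in_setU nn orbF => /andP [_ z1].
      by rewrite !pos.
    have := subsetP H2 z z3; rewrite in_setD1 in_setU np orbF => /andP [_ z1].
    by rewrite !neg.
  have zX : z \in X by have [_] := sub z zZ; rewrite in_setU (negPf zY) orbF.
  by rewrite as_ // E s1 //; ring: a2 x2.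
have [np nn] : (z \in spos Z1) = false /\ (z \in sneg Z1) = false.
  by apply: notin; rewrite E1.
have E : sgn Z3 z = - sgn Z2 z.
  move: zZ; rewrite in_setU => /orP [] z3.
    have := subsetP H1 z z3; rewrite in_setD1 in_setU np => /andP [_ z1].
    by rewrite pos // neg // opprK.
  have := subsetP H2 z z3; rewrite in_setD1 in_setU nn => /andP [_ z1].
  by rewrite neg // pos.
have zY : z \in Y by have [_] := sub z zZ; rewrite in_setU (negPf zX).
by rewrite as_ // E s2 //; ring: a2.
Qed.

Lemma underlying_matroid : matroid_circuits (underlying SC).
Proof.
have [h0 hd ho hi he] := hS; split.
- apply/imsetP => -[Z ZS Z0]; case/negP: h0; suff <- : Z = set0 by [].
  apply/eqP; rewrite -subset0; apply/subsetP => -[b x] xZ.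
  have : x \in ssupp Z by rewrite !inE; case: b xZ => ->; rewrite ?orbT.
  by rewrite -Z0 inE.
- move=> _ _ /imsetP [Z ZS ->] /imsetP [Z' ZS' ->] /(hi _ _ ZS ZS').
  by case=> ->; rewrite ?ssupp_sopp.
- move=> X Y e XC YC nXY; rewrite in_setI => /andP [eX eY].
  by have [Z []] := circuit_sgn_elim XC YC nXY eX eY; exists Z.
Qed.

Section SignedPerm.
Variable g : {perm bool * 'I_n}.
Hypothesis hg : om_aut SC g.

Definition sp_sgn i : K := if (g (false, i)).1 then -1 else 1.

Lemma sp_sgn2 i : sp_sgn i * sp_sgn i = 1.
Proof. by rewrite /sp_sgn; case: ifP => _; rewrite ?mulrNN mulr1. Qed.

(** The sign of g at i is put on the argument, so that membership in an image [g @: Z] can be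
    rewritten. *)
Lemma signed_permE b i : g (b (+) (g (false, i)).1, i) = (b, sp_map g i).
Proof.
have [gs _] := hg; have := gs false i; rewrite /sp_map.
case gE : (g (false, i)) => [[|] k] /= gt; case: b => //=; by rewrite ?gt ?gE.
Qed.

Lemma sp_map_inj : injective (sp_map g).
Proof.
move=> i j ij; have := signed_permE false i; have := signed_permE false j.
by rewrite ij => <- /perm_inj [].
Qed.

Lemma mem_signed_image b i Z :
  ((b, sp_map g i) \in g @: Z) = ((b (+) (g (false, i)).1, i) \in Z).
Proof. by rewrite -signed_permE mem_imset //; apply: perm_inj. Qed.

Lemma ssupp_image Z : ssupp (g @: Z) = sp_map g @: ssupp Z.
Proof.
have sup i : (sp_map g i \in ssupp (g @: Z)) = (i \in ssupp Z).
  by rewrite !inE !mem_signed_image; case: (g _).1 => //=; rewrite orbC.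
apply/setP => x; apply/idP/imsetP => [|[i iZ ->]]; last by rewrite sup.
have /codomP [i ->] : x \in codom (sp_map g).
  by have := injF_onto sp_map_inj; move=> /(_ x); apply.
by rewrite sup; exists i.
Qed.

Lemma signed_image X : X \in underlying SC -> sp_map g @: X \in underlying SC /\
  exists2 a : K, a * a = 1 & {in X, forall c,
    circuit_sgn (sp_map g @: X) (sp_map g c) = a * sp_sgn c * circuit_sgn X c}.
Proof.
move=> XC; have [RS RE] := repr_circuitP XC; set Z := repr_circuit X in RS RE.
have [_ gSC] := hg; have ZS : g @: Z \in SC by rewrite gSC.
have sE : ssupp (g @: Z) = sp_map g @: X by rewrite ssupp_image RE.
split; first by rewrite -sE imset_f.
have [a a2 sa] := circuit_sgnP ZS; exists a => // c cX.
have := sa (sp_map g c); rewrite sE imset_f // => /(_ isT) e.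
transitivity (a * sgn (g @: Z) (sp_map g c)); first by rewrite e; ring: a2.
rewrite -mulrA; congr (_ * _); rewrite /circuit_sgn -/Z /sgn /sp_sgn !inE mem_signed_image.
have cZ : c \in ssupp Z by rewrite RE.
have := sneg_spos RS cZ; rewrite !inE.
case: (g (false, c)).1 => /= [->|_]; last by rewrite mul1r.
by case: ((false, c) \in Z); rewrite mulN1r ?opprK.
Qed.

End SignedPerm.

End OrientedMatroid.

(** * Specialisation to the two algebras *)

Section Assembly.
Set Implicit Arguments. Unset Strict Implicit. Unset Printing Implicit Defensive.
Variables (K : fieldType) (n r : nat).

Lemma flag_hyperplane (C : {set {set 'I_n}}) (Fl : nat -> {set 'I_n}) :
  matroid_circuits C -> simple_matroid C -> rk C setT = r -> (0 < r)%N ->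
  complete_modular_flag C r Fl ->
  flat C (Fl r.-1) /\ forall j k, j \notin Fl r.-1 -> k \notin Fl r.-1 -> j != k ->
    exists2 i, i \in Fl r.-1 & [set i; j; k] \in C.
Proof.
move=> hC sC rC r0 [_ _ _ rkF modF].
have mF := modF r.-1 (leq_pred r); split; first by case/andP: mF.
move=> j k; apply: (modular_hyperplane_line hC sC mF).
by rewrite rkF ?leq_pred // prednK.
Qed.

Lemma OS_ses (C : {set {set 'I_n}}) (Fl : nat -> {set 'I_n}) (G : {group {perm 'I_n}}) :
  matroid_circuits C -> simple_matroid C -> rk C setT = r -> (0 < r)%N ->
  complete_modular_flag C r Fl -> (forall g, g \in G -> mat_aut C g) ->
  let F := Fl r.-1 in let acts := perm_acts (K:=K) G F in
  let RA := OS_rels (K:=K) C setT in let RB := OS_rels (K:=K) C F in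
  ses acts (ideal_mem RB) (ideal_mem RA) (XshiftB F RB) /\
  ses acts (XshiftB F (koszul_rels RA setT)) (ideal_mem (koszul_rels RA setT))
           (ideal_mem (koszul_rels RB F)).
Proof.
move=> hC sC rC r0 flagF autG F acts RA RB.
have [fF lineF] := flag_hyperplane hC sC rC r0 flagF.
have one2 : (1 : K) * 1 = 1 by rewrite mulr1.
have N12 : (-1 : K) * -1 = 1 by rewrite mulrNN mulr1.
have elim1 X Y e : X \in C -> Y \in C -> X != Y -> e \in X -> e \in Y ->
  exists2 Z, Z \in C /\ Z \subset (X :|: Y) :\ e & exists a : K,
    [/\ a * a = 1, {in Z, forall z, z \notin Y -> a * 1 = 1} &
        {in Z, forall z, z \notin X -> a * 1 = - (-1) * 1 * 1 * 1}].
  move=> XC YC nXY eX eY; have [_ _ he] := hC.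
  have [|Z ZC ZS] := he X Y e XC YC nXY; first by rewrite inE eX.
  (* With all signs 1 and [- q = 1], ordinary circuit elimination satisfies the sign conditions for
     a = 1. *)
  exists Z => //; exists 1; split=> // z _ _.
  by rewrite opprK !mulr1.
have hom S : forall r, OS_rels (K:=K) C S r -> exists d, homog d r.
  move=> p /OS_rels_presented; apply: presented_homog => _ [X [_ _ ->]].
  by rewrite dOS_qder; eexists; apply: qder_size.
apply: (@signed_ses K n C F (-1) (fun _ _ => 1) N12 hC sC fF lineF
          (fun _ _ _ _ => one2) elim1 acts RA RB (hom _) (hom _)).
- move=> psi; rewrite (ann_iff _ (@OS_rels_presented K n C setT)) ann_presented.
  split=> [[_ Qpsi H]|[Qpsi H]]; split=> //.
  + by move=> X XC u w; rewrite /circuit_rel -dOS_qder; apply: H; exists X; rewrite subsetT.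
  + by move=> w /allPn [x _] /=; rewrite inE.
  + by move=> _ [X [XC _ ->]] u w; rewrite dOS_qder; apply: H.
- move=> psi; rewrite (ann_iff _ (@OS_rels_presented K n C F)) ann_presented /annB.
  split=> -[H1 H2 H]; split=> // _ [X [XC XF ->]] u w.
    by rewrite /circuit_rel -dOS_qder; apply: H; exists X.
  by rewrite dOS_qder; apply: H; exists X.
move=> h [g /andP [gG /eqP gF] ->].
apply: (equivariant_signed (sg := fun _ _ => 1)) => //.
- exact: perm_inj.
- by move=> i; rewrite -{1}gF mem_imset //; apply: perm_inj.
- move=> X XC; split; first by rewrite autG.
  by exists 1 => // c _; rewrite !mulr1.
Qed.

Lemma VG_ses (SC : {set {set bool * 'I_n}}) (Fl : nat -> {set 'I_n})
    (G : {group {perm bool * 'I_n}}) :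
  oriented_matroid SC -> simple_matroid (underlying SC) ->
  rk (underlying SC) setT = r -> (0 < r)%N ->
  complete_modular_flag (underlying SC) r Fl -> (forall g, g \in G -> om_aut SC g) ->
  let F := Fl r.-1 in let acts := sperm_acts (K:=K) G F in
  let RA := VG_rels (K:=K) SC setT in let RB := VG_rels (K:=K) SC F in
  ses acts (ideal_mem RB) (ideal_mem RA) (XshiftB F RB) /\
  ses acts (XshiftB F (koszul_rels RA setT)) (ideal_mem (koszul_rels RA setT))
           (ideal_mem (koszul_rels RB F)).
Proof.
move=> hS sC rC r0 flagF autG F acts RA RB.
have hC := underlying_matroid K hS.
have [fF lineF] := flag_hyperplane hC sC rC r0 flagF.
have one2 : (1 : K) * 1 = 1 by rewrite mulr1.
have hom S : forall r, VG_rels (K:=K) SC S r -> exists d, homog d r.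
  move=> p /VG_rels_presented; apply: presented_homog => _ [X [_ _ ->]].
  by rewrite dVG_qder; eexists; apply: qder_size.
(* A signed circuit and the representative of its support give the same relation up to a sign. *)
have rel Z psi u w : Z \in SC -> exists2 a : K, a * a = 1 &
    ev (dVG K Z) (fun z => psi (u ++ z ++ w)) =
    a * ev (circuit_rel 1 (circuit_sgn K SC) (ssupp Z)) (fun z => psi (u ++ z ++ w)).
  move=> ZS; have [a a2 sa] := circuit_sgnP K hS ZS; exists a => //.
  rewrite dVG_qder; apply: ev_qder_scale => c; rewrite mem_sorted_enum; exact: sa.
have relE (S : {set 'I_n}) psi : ann (fun r => exists Z,
      [/\ Z \in SC, ssupp Z \subset S & r = dVG K Z]) psi <->
    (forall X, X \in underlying SC -> X \subset S -> forall u w,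
       ev (circuit_rel 1 (circuit_sgn K SC) X) (fun z => psi (u ++ z ++ w)) = 0).
  split=> [H _ /imsetP [Z ZS ->] ZF u w|H _ [Z [ZS ZF ->]] u w].
    have [a a2 E] := rel Z psi u w ZS.
    move: E; rewrite H; last by exists Z.
    by move/esym/eqP; rewrite mulf_eq0 => /orP [/eqP a0|/eqP //];
       move/eqP: a2; rewrite a0 mul0r eq_sym oner_eq0.
  have [a a2 ->] := rel Z psi u w ZS.
  by rewrite H ?mulr0 //; apply: imset_f.
apply: (@signed_ses K n (underlying SC) F 1 (circuit_sgn K SC) one2 hC sC fF lineF
          (fun _ _ _ _ => sgn2 K _ _) (circuit_sgn_elim K hS) acts RA RB (hom _) (hom _)).
- move=> psi; rewrite (ann_iff _ (@VG_rels_presented K n SC setT)) ann_presented.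
  split=> [[_ Qpsi /relE H]|[Qpsi H]]; split=> //.
  + by move=> X XC; apply: H; rewrite ?subsetT.
  + by move=> w /allPn [x _] /=; rewrite inE.
  + by apply/relE => X XC _; apply: H.
- move=> psi; rewrite (ann_iff _ (@VG_rels_presented K n SC F)) ann_presented /annB.
  split=> -[H1 H2 H]; split=> //.
    by move/relE: H => H _ [X [XC XF ->]]; apply: H.
  by apply/relE => X XC XF; apply: H; exists X.
move=> h [g /andP [gG /eqP gF] ->]; have hg := autG g gG.
apply: (equivariant_signed (sg := circuit_sgn K SC)) => //.
- exact: circuit_sgn_elim.
- exact: sp_map_inj hg.
- by move=> i; rewrite -{1}gF mem_imset //; apply: sp_map_inj hg.
- exact: sp_sgn2.
- exact: signed_image.
Qed.

End Assembly.

Theorem theorem7p1 (K : fieldType) (n r : nat) :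
  (forall (C : {set {set 'I_n}}) (Fl : nat -> {set 'I_n})
          (G : {group {perm 'I_n}}),
     matroid_circuits C -> simple_matroid C -> rk C setT = r -> (0 < r)%N ->
     complete_modular_flag C r Fl ->
     (forall g, g \in G -> mat_aut C g) ->
     let F := Fl r.-1 in
     let acts := perm_acts (K:=K) G F in
     let RA := OS_rels (K:=K) C setT in
     let RB := OS_rels (K:=K) C F in
     ses acts (ideal_mem RB) (ideal_mem RA) (XshiftB F RB) /\
     ses acts (XshiftB F (koszul_rels RA setT))
              (ideal_mem (koszul_rels RA setT))
              (ideal_mem (koszul_rels RB F)))
  /\
  (forall (SC : {set {set bool * 'I_n}}) (Fl : nat -> {set 'I_n})
          (G : {group {perm bool * 'I_n}}),
     oriented_matroid SC -> simple_matroid (underlying SC) ->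
     rk (underlying SC) setT = r -> (0 < r)%N ->
     complete_modular_flag (underlying SC) r Fl ->
     (forall g, g \in G -> om_aut SC g) ->
     let F := Fl r.-1 in
     let acts := sperm_acts (K:=K) G F in
     let RA := VG_rels (K:=K) SC setT in
     let RB := VG_rels (K:=K) SC F in
     ses acts (ideal_mem RB) (ideal_mem RA) (XshiftB F RB) /\
     ses acts (XshiftB F (koszul_rels RA setT))
              (ideal_mem (koszul_rels RA setT))
              (ideal_mem (koszul_rels RB F))).
Proof.
by split=> [C Fl G|SC Fl G]; [apply: OS_ses|apply: VG_ses].
Qed.
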